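(* Let $n\ge3$, $H$, $\Omega$, $u$, $U$, $H^\gamma$, $u^\gamma$, $u^{\gamma,\epsilon}$ be as in the context, with $U=B(0,3)$, and let $e_n=(0,\dots,0,1)$. There is a constant $C_1(\lambda,\Lambda)$ depending only on $\lambda$ and $\Lambda$ with the following property. Suppose that for some $\gamma,\epsilon\in(0,1]$ the function $u^{\gamma,\epsilon}$ satisfies $$\max_{B(0,3)}|u^{\gamma,\epsilon}-x_n|\le\tau$$ for some $0<\tau<1$, and $$H^\gamma(Du^{\gamma,\epsilon}(x_0))\ge H^\gamma(e_n)-\delta$$ for some $0<\delta<H(e_n)/2$ and some $x_0\in B(0,1)$. Then $$|Du^{\gamma,\epsilon}(x_0)-e_n|^2\le C_1(\lambda,\Lambda)\left[\tau+\delta+\frac1\epsilon e^{-\frac{\mu\delta}{\epsilon}}\right],\qquad\text{where }\mu=\frac{\lambda}{16n}.$$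
   Context: Absolute minimizers: for a continuous $H:\mathbb{R}^n\to\mathbb{R}$, a domain $\Omega\subset\mathbb{R}^n$ and $u\in W^{1,\infty}_{\mathrm{loc}}(\Omega)$ put $\mathcal{F}_H(u,\Omega)=\operatorname{ess\,sup}_{x\in\Omega}H(Du(x))$; $u\in AM_H(\Omega)$ means $u\in W^{1,\infty}_{\mathrm{loc}}(\Omega)$ and $\mathcal{F}_H(u,V)\le\mathcal{F}_H(v,V)$ whenever $V\Subset\Omega$, $v\in W^{1,\infty}_{\mathrm{loc}}(V)\cap C(\overline V)$ and $u=v$ on $\partial V$. Standing assumptions: the dimension $n\ge3$ is fixed; $H\in C^0(\mathbb{R}^n)$ is such that there exist $0<\lambda\le\Lambda<\infty$ for which both $H(p)-\frac\lambda2|p|^2$ and $\frac\Lambda2|p|^2-H(p)$ are convex in $\mathbb{R}^n$, and $H(0)=\min_{p\in\mathbb{R}^n}H(p)=0$. $\Omega\subset\mathbb{R}^n$ is a domain, $u\in AM_H(\Omega)$, and $U\Subset\Omega$ is a subdomain. Approximations: for $\gamma\in(0,1]$ let $\widetilde H^\gamma=\eta_\gamma*H$ with $\eta_\gamma$ the standard smooth mollifier, let $p^\gamma\in\mathbb{R}^n$ be the unique minimum point of $\widetilde H^\gamma$, and set $H^\gamma(p)=\widetilde H^\gamma(p+p^\gamma)-\widetilde H^\gamma(p^\gamma)$. (Then $H^\gamma$ is smooth and satisfies the same assumptions as $H$ with the same $\lambda,\Lambda$.) Let $u^\gamma\in AM_{H^\gamma}(U)\cap C^0(\overline U)$ with $u^\gamma=u$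 on $\partial U$. For $\epsilon\in(0,1]$, $u^{\gamma,\epsilon}\in C^\infty(U)\cap C^0(\overline U)$ is the unique solution of $\sum_{i,j}H^\gamma_{p_i}(Dv)H^\gamma_{p_j}(Dv)v_{x_ix_j}+\epsilon\Delta v=0$ in $U$, $v=u^\gamma$ on $\partial U$. Subscripts $p_i$, $x_i$ denote partial derivatives. *)

(* Defs.v *)
From HB Require Import structures.
From mathcomp Require Import all_boot all_order all_algebra.
From mathcomp Require Import all_classical all_reals all_analysis ess_sup_inf.

Set Implicit Arguments.
Unset Strict Implicit.
Unset Printing Implicit Defensive.

Import Order.TTheory GRing.Theory Num.Theory.
Import numFieldNormedType.Exports.

Local Open Scope classical_set_scope.
Local Open Scope ring_scope.

(* Points of R^n are row vectors.  Their library norm is the sup norm, which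
   gives the usual topology; the Euclidean norm has to be defined separately. *)

Definition dot (R : realType) (n : nat) (x y : 'rV[R]_n) : R :=
  \sum_(i < n) x 0 i * y 0 i.

Definition enorm (R : realType) (n : nat) (x : 'rV[R]_n) : R :=
  Num.sqrt (dot x x).

Definition eball (R : realType) (n : nat) (r : R) : set 'rV[R]_n :=
  [set x | enorm x < r].

(* e_n = (0, ..., 0, 1); the n-th coordinate of x is [dot x (e_last R n)]. *)
Definition e_last (R : realType) (n : nat) : 'rV[R]_n :=
  \row_(i < n) (i.+1 == n)%:R.

Definition frontier (T : topologicalType) (A : set T) : set T :=
  closure A `\` interior A.

Definition domain (T : topologicalType) (A : set T) : Prop :=
  [/\ open A, connected A & A !=set0].

Definition compactly_contained (T : topologicalType) (V W : set T) : Prop :=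
  compact (closure V) /\ closure V `<=` W.

Definition partial (R : realType) (n : nat) (i : 'I_n) (f : 'rV[R]_n -> R) :
  'rV[R]_n -> R := fun x => 'D_(delta_mx 0 i) f x.

Definition grad (R : realType) (n : nat) (f : 'rV[R]_n -> R) :
  'rV[R]_n -> 'rV[R]_n := fun x => \row_i partial i f x.

Fixpoint Ck_on (R : realType) (n k : nat) (U : set 'rV[R]_n)
    (f : 'rV[R]_n -> R) : Prop :=
  (forall x, U x -> {for x, continuous f}) /\
  if k is k'.+1 then
    forall i : 'I_n, (forall x, U x -> derivable f x (delta_mx 0 i)) /\
      Ck_on k' U (partial i f)
  else True.

Definition smooth_on (R : realType) (n : nat) (U : set 'rV[R]_n)
    (f : 'rV[R]_n -> R) : Prop :=
  forall k : nat, Ck_on k U f.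

Section lebesgue_measure_step.
Context (R : realType) (n : nat).
Let T := measurableTypeR R.
Variable nu : {sigma_finite_measure set (n.-tuple T) -> \bar R}.

Let tcons (p : T * n.-tuple T) : n.+1.-tuple T :=
  [the n.+1.-tuple T of p.1 :: p.2].

Let measurable_tcons : measurable_fun [set: T * n.-tuple T] tcons.
Proof. exact: measurable_cons. Qed.

Definition leb_step : set (n.+1.-tuple T) -> \bar R :=
  pushforward (@lebesgue_measure R \x nu)%E tcons.

Let leb_step0 : leb_step set0 = 0%E.
Proof. by rewrite /leb_step /pushforward preimage_set0 measure0. Qed.

Let leb_step_ge0 A : (0 <= leb_step A)%E.
Proof. exact: measure_ge0. Qed.

Let leb_step_sigma_additive : semi_sigma_additive leb_step.
Proof.
move=> F mF tF mUF; rewrite /leb_step /pushforward preimage_bigcup.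
apply: measure_semi_sigma_additive.
- by move=> k; rewrite -[X in measurable X]setTI; exact: measurable_tcons.
- apply/trivIsetP => /= i j _ _ ij; rewrite -preimage_setI.
  by move/trivIsetP : tF => /(_ _ _ _ _ ij) ->//; rewrite preimage_set0.
- rewrite -preimage_bigcup -[X in measurable X]setTI.
  exact: measurable_tcons.
Qed.

HB.instance Definition _ := isMeasure.Build _ _ _ leb_step
  leb_step0 leb_step_ge0 leb_step_sigma_additive.

Let leb_step_sigma_finite : sigma_finite setT leb_step.
Proof.
have /sigma_finiteP[F [FT ndF Foo]] := sigma_finiteT (@lebesgue_measure R).
have /sigma_finiteP[G [GT ndG Goo]] := sigma_finiteT nu.
pose g (t : n.+1.-tuple T) : T * n.-tuple T := (thead t, [tuple of behead t]).
have mg : measurable_fun setT g.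
  apply/measurable_fun_pairP; split.
  - exact: (measurable_tnth ord0).
  - exact: measurable_behead.
exists (fun k => g @^-1` (F k `*` G k)).
  apply/esym/seteqP; split => // t _.
  have [i _ Fi] : (\bigcup_i F i) (g t).1 by rewrite -FT.
  have [j _ Gj] : (\bigcup_i G i) (g t).2 by rewrite -GT.
  exists (maxn i j) => //; split => /=.
  - by move: Fi; exact/subsetPset/ndF/leq_maxl.
  - by move: Gj; exact/subsetPset/ndG/leq_maxr.
move=> k; have [mF Fk] := Foo k; have [mG Gk] := Goo k; split.
  by rewrite -[_ @^-1` _]setTI; apply: mg => //; exact: measurableX.
rewrite /leb_step /pushforward.
have -> : tcons @^-1` (g @^-1` (F k `*` G k)) = F k `*` G k.
  apply/seteqP; split => -[a b]; rewrite /preimage/= /g.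
  - by rewrite (_ : [tuple of behead (tcons (a, b))] = b)//; exact/val_inj.
  - by rewrite (_ : [tuple of behead (tcons (a, b))] = b)//; exact/val_inj.
by rewrite product_measure1E// lte_mul_pinfty// ge0_fin_numE.
Qed.

HB.instance Definition _ :=
  Measure_isSigmaFinite.Build _ _ _ leb_step leb_step_sigma_finite.

End lebesgue_measure_step.

(* n-dimensional Lebesgue measure: the product measure on n-tuples of reals. *)
Fixpoint leb (R : realType) (n : nat) :
    {sigma_finite_measure set (n.-tuple (measurableTypeR R)) -> \bar R} :=
  match n with
  | 0 => @dirac _ (0.-tuple (measurableTypeR R)) [tuple] R
  | m.+1 => leb_step (leb R m)
  end.

(* Integrals over R^n and almost-everywhere statements are written through
   the identification of n-tuples with row vectors. *)
Definition vec (R : realType) (n : nat) (t : n.-tuple (measurableTypeR R)) :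
  'rV[R]_n := \row_(i < n) (tnth t i : R).

Definition test_function (R : realType) (n : nat) (U : set 'rV[R]_n)
    (phi : 'rV[R]_n -> R) : Prop :=
  smooth_on setT phi /\
  exists K : set 'rV[R]_n,
    [/\ compact K, K `<=` U & forall x, ~ K x -> phi x = 0].

Definition L1_loc (R : realType) (n : nat) (U : set 'rV[R]_n)
    (f : 'rV[R]_n -> R) : Prop :=
  forall K : set 'rV[R]_n, compact K -> K `<=` U ->
    (leb R n).-integrable (@vec R n @^-1` K) (EFin \o f \o @vec R n).

Definition Linfty_loc (R : realType) (n : nat) (U : set 'rV[R]_n)
    (f : 'rV[R]_n -> R) : Prop :=
  measurable_fun (@vec R n @^-1` U) (f \o @vec R n) /\
  forall K : set 'rV[R]_n, compact K -> K `<=` U ->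
    exists M : R, {ae leb R n, forall t, K (vec t) -> `|f (vec t)| <= M}.

Definition is_weak_grad (R : realType) (n : nat) (U : set 'rV[R]_n)
    (u : 'rV[R]_n -> R) (g : 'rV[R]_n -> 'rV[R]_n) : Prop :=
  forall i : 'I_n,
    L1_loc U (fun x => g x 0 i) /\
    forall phi, test_function U phi ->
      \int[leb R n]_(t in @vec R n @^-1` U) (u (vec t) * partial i phi (vec t))
      = - \int[leb R n]_(t in @vec R n @^-1` U) (g (vec t) 0 i * phi (vec t)).

(* The weak gradient, unique up to a null set when it exists. *)
Definition weak_grad (R : realType) (n : nat) (U : set 'rV[R]_n)
    (u : 'rV[R]_n -> R) : 'rV[R]_n -> 'rV[R]_n :=
  get [set g | is_weak_grad U u g].

(* Every class in W^{1,oo}_loc has exactly one continuous representative, and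
   it is that representative which is meant. *)
Definition W1infty_loc (R : realType) (n : nat) (U : set 'rV[R]_n)
    (u : 'rV[R]_n -> R) : Prop :=
  [/\ {within U, continuous u}, Linfty_loc U u &
      exists g, is_weak_grad U u g /\
        forall i : 'I_n, Linfty_loc U (fun x => g x 0 i)].

(* The library's essential supremum ranges over the whole space; giving the
   integrand the value -oo outside V restricts it to V. *)
Definition sup_functional (R : realType) (n : nat) (H : 'rV[R]_n -> R)
    (u : 'rV[R]_n -> R) (V : set 'rV[R]_n) : \bar R :=
  ess_sup (leb R n)
    (patch (fun=> -oo%E) (@vec R n @^-1` V)
       (fun t => (H (weak_grad V u (vec t)))%:E)).

Definition absolute_minimizer (R : realType) (n : nat) (H : 'rV[R]_n -> R)
    (U : set 'rV[R]_n) (u : 'rV[R]_n -> R) : Prop :=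
  W1infty_loc U u /\
  forall (V : set 'rV[R]_n) (v : 'rV[R]_n -> R),
    open V -> compactly_contained V U ->
    W1infty_loc V v -> {within closure V, continuous v} ->
    (forall x, frontier V x -> u x = v x) ->
    (sup_functional H u V <= sup_functional H v V)%E.

Definition mollifier_kernel (R : realType) (n : nat) (y : 'rV[R]_n) : R :=
  if enorm y < 1 then expR (- (1 - enorm y ^+ 2)^-1) else 0.

Definition mollifier (R : realType) (n : nat) (gamma : R) (y : 'rV[R]_n) : R :=
  (\int[leb R n]_t mollifier_kernel (vec t))^-1 * gamma ^- n *
  mollifier_kernel (gamma^-1 *: y).

Definition mollify (R : realType) (n : nat) (gamma : R) (H : 'rV[R]_n -> R)
    (p : 'rV[R]_n) : R :=
  \int[leb R n]_t (mollifier gamma (p - vec t) * H (vec t)).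

Definition unique_min_point (R : realType) (n : nat) (f : 'rV[R]_n -> R)
    (p : 'rV[R]_n) : Prop :=
  forall q, q != p -> f p < f q.

(* This is H^gamma when p is the minimum point p^gamma of the mollified H. *)
Definition regularized (R : realType) (n : nat) (gamma : R)
    (H : 'rV[R]_n -> R) (p : 'rV[R]_n) : 'rV[R]_n -> R :=
  fun q => mollify gamma H (q + p) - mollify gamma H p.

Definition admissible (R : realType) (n : nat) (lambda Lambda : R)
    (H : 'rV[R]_n -> R) : Prop :=
  [/\ continuous H,
      @convex_function R 'rV[R]_n setT
        (fun p => H p - lambda / 2 * enorm p ^+ 2),
      @convex_function R 'rV[R]_n setT
        (fun p => Lambda / 2 * enorm p ^+ 2 - H p),
      H 0 = 0 & forall p, 0 <= H p].

Definition aronsson_eps (R : realType) (n : nat) (H : 'rV[R]_n -> R) (eps : R)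
    (v : 'rV[R]_n -> R) (x : 'rV[R]_n) : R :=
  \sum_(i < n) \sum_(j < n)
    partial i H (grad v x) * partial j H (grad v x) *
    partial j (partial i v) x +
  eps * \sum_(i < n) partial i (partial i v) x.

Definition is_solution_eps (R : realType) (n : nat) (H : 'rV[R]_n -> R)
    (eps : R) (U : set 'rV[R]_n) (g v : 'rV[R]_n -> R) : Prop :=
  [/\ smooth_on U v, {within closure U, continuous v},
      forall x, U x -> aronsson_eps H eps v x = 0 &
      forall x, frontier U x -> v x = g x].

(* Main.v *)
From HB Require Import structures.
Require Import Defs.
From mathcomp Require Import all_boot all_order all_algebra.
From mathcomp Require Import all_classical all_reals all_analysis.
From mathcomp Require Import measurable_realfun ring lra.

(** Write [v] for the solution of the regularised equation, [F] for the regularised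
    Hamiltonian, [e] for the last basis vector, [p = Dv], [sigma = tau + delta], and
    [g(p) = F(p) - F(e) - DF(e).(p - e)], which is comparable with [|p - e|^2]. The
    estimate is a maximum principle on the ball of radius 2 for
<<
      w = (4 - |x|^2)^2 g(Dv) + (A/sigma) (v - e.x)^2
            - M exp(- (mu/eps) (F(Dv) - F(e) + 2 delta)).
>>
    At [x0] the first term is at least [9 lambda/2 |p - e|^2] and the barrier term is at
    least [- M exp(- mu delta/eps)], so it is enough to show that the maximum of [w] is
    [O(sigma)] ([flatness_estimate]). The squared deviation is always [O(sigma)]. So the
    claim is clear if the maximum is on the sphere of radius 2, if
    [(4 - |x|^2)^2 |p - e|^2] is [O(sigma)] there, or if [F(p) < F(e) - 2 delta]: in this
    last case [p] is bounded and the barrier term outweighs the first one.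

    In the remaining case ([no_interior_max]) put [P = DF(p)]. As [F(p)] is not much smaller
    than [F(e)] and [|p - e|^2] is large compared with [sigma], convexity gives
    [P.(p - e) >= lambda/4 |p - e|^2]. Apply the second derivative test to [w] along [P], with weight [1], and along the coordinate
    vectors, with weight [eps]. The squared deviation contributes
    [2 (A/sigma) (P.(p - e))^2], of order [|p - e|^4 / sigma], while its terms in [D^2 v]
    cancel by the equation. The first term contributes
    [(4 - |x|^2)^2 lambda |D^2 v P|^2], cutoff errors that this absorbs, and third
    derivatives. The latter, together with those of the barrier, make up the equation
    differentiated along a vector [N], and the first order condition [Dw = 0] expresses
    [D^2 v N] by lower order quantities, so they are controlled as well
    ([pde_derivative]). The barrier contributes
<<
      lambda |b|^2 - (mu/eps) (P.b)^2
        + eps (lambda |D^2 v|^2 - (mu/eps) |b|^2),     b = D^2 v P,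
>>
    times a nonnegative factor; it is nonnegative, because the equation reads
    [P.b = - eps Delta v] and [mu n <= lambda]. The errors left are of order
    [|p - e|^4 + |p - e|^2]. For [A] large the term of order [|p - e|^4 / sigma] outweighs
    them, since [(4 - |x|^2)^2 |p - e|^2] is a large multiple of [sigma]
    ([interior_absurd]); so the sum of the second derivatives is positive, a
    contradiction.

    The Hamiltonian enters through its two-sided quadratic convexity, which survives
    mollification because it is stable under averages ([regularized_quad_convex]). It
    gives the quadratic expansion of [F] and the Lipschitz bound for [DF]
    ([quad_convex_expansion], [grad_lipschitz]); in the second derivative test, [F(Dv)] is
    replaced by a paraboloid in [Dv] touching it from below ([touching_jets]). *)

Set Implicit Arguments.
Unset Strict Implicit.
Unset Printing Implicit Defensive.

Import Order.TTheory GRing.Theory Num.Theory.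
Import numFieldNormedType.Exports.

Local Open Scope classical_set_scope.
Local Open Scope ring_scope.

(** * Linear changes of variable for Lebesgue measure *)

Definition mfun_of {d1 d2} {X : measurableType d1} {Y : measurableType d2}
    {phi : X -> Y} (mphi : measurable_fun setT phi) : {mfun X >-> Y} :=
  let mixin := isMeasurableFun.Build _ _ _ _ phi mphi in
  HB.pack phi mixin.

(** Both sides are measures in [A], and they agree on half-open intervals. *)
Lemma lebesgue_affine (R : realType) (a b : R) : 0 < a ->
  forall A : set (measurableTypeR R), measurable A ->
  lebesgue_measure A =
  (a%:E * lebesgue_measure ((fun x => a * x + b)%R @^-1` A))%E.
Proof.
move=> a0 A mA.
have mphi : measurable_fun setT (fun x : measurableTypeR R => (a * x + b)%R : measurableTypeR R).
  by apply: measurable_funD => //; exact: measurable_funM.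
pose phi : {mfun measurableTypeR R >-> measurableTypeR R} :=
  mfun_of mphi.
have := @lebesgue_measure_unique R
  (mscale (NngNum (ltW a0)) (pushforward lebesgue_measure phi)) _ A mA.
apply => _ [[x y] _ <-].
rewrite [RHS](_ : _ = a%:E * lebesgue_measure (phi @^-1` `]x, y]%classic))%E; last by [].
rewrite (_ : _ @^-1` _ = `](a^-1 * (x - b)), (a^-1 * (y - b))]%classic); last first.
  apply/seteqP; split => z /=; rewrite !in_itv/= => /andP[h1 h2]; apply/andP; split.
  - by rewrite ltr_pdivrMl// ltrBlDr.
  - by rewrite ler_pdivlMl// lerBrDr.
  - by rewrite -ltrBlDr -ltr_pdivrMl.
  - by rewrite -lerBrDr -ler_pdivlMl.
rewrite !lebesgue_measure_itv/= !lte_fin ltr_pM2l ?invr_gt0// ltrD2r.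
case: ifP => _; last by rewrite mule0.
rewrite -!EFinB -EFinM; congr (_%:E).
by rewrite -mulrBr mulrA divff ?gt_eqF// mul1r opprD opprK addrACA addNr addr0.
Qed.

(** Dilations and reflections of the line are the two substitutions needed on
    mollifiers; recording only that they have constant Jacobian lets one induction
    on the dimension serve both. *)
Definition subst_by (R : realType) (c : R)
    (phi : measurableTypeR R -> measurableTypeR R) : Prop :=
  measurable_fun setT phi /\
  forall f : measurableTypeR R -> \bar R, measurable_fun setT f ->
    (forall x, 0 <= f x)%E ->
    (\int[lebesgue_measure]_x f (phi x) =
     c%:E * \int[lebesgue_measure]_x f x)%E.

Lemma subst_by_dilation (R : realType) (a : R) : 0 < a ->
  subst_by (a^-1) (fun x => a * x).
Proof.
move=> a0.
have mphi : measurable_fun setT (fun x : measurableTypeR R => (a * x)%R : measurableTypeR R).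
  exact: measurable_funM.
split=> // f mf f0.
have ai0 : 0 <= a^-1 by rewrite invr_ge0 ltW.
rewrite -(@ge0_integral_mscale _ _ _ _ _ measurableT (NngNum ai0))//.
pose phi : {mfun measurableTypeR R >-> measurableTypeR R} :=
  mfun_of mphi.
rewrite -[LHS](@ge0_integral_pushforward _ _ _ _ _ phi mphi lebesgue_measure setT)//.
apply: eq_measure_integral => A mA _ /=.
rewrite /mscale/= (@lebesgue_affine R a 0 a0 A mA) muleA -EFinM mulVf ?gt_eqF// mul1e.
by rewrite /pushforward; congr (lebesgue_measure _); apply/funext => z /=; rewrite /preimage/= addr0.
Qed.

Lemma subst_by_reflection (R : realType) (b : R) : subst_by 1 (fun x => b - x).
Proof.
have mN : measurable_fun setT (fun x : measurableTypeR R => (- x)%R : measurableTypeR R).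
  exact: measurableT_comp.
have mphi : measurable_fun setT (fun x : measurableTypeR R => (b - x)%R : measurableTypeR R).
  exact: measurable_funB.
split=> // f mf f0; rewrite mul1e.
pose phi : {mfun measurableTypeR R >-> measurableTypeR R} :=
  mfun_of mphi.
rewrite -[LHS](@ge0_integral_pushforward _ _ _ _ _ phi mphi lebesgue_measure setT)//.
apply: eq_measure_integral => A mA _ /=.
rewrite [RHS](@lebesgue_affine R 1 b ltr01 A mA) mul1e.
rewrite -[RHS]lebesgue_measureN; last first.
  rewrite -[X in measurable X]setTI.
  have : measurable_fun setT (fun x : measurableTypeR R => (1 * x + b)%R : measurableTypeR R).
    by apply: measurable_funD => //; exact: measurable_funM.
  exact.
by rewrite /pushforward; congr (lebesgue_measure _); apply/funext => z /=; rewrite /preimage/= mul1r addrC.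
Qed.

(** [leb] is defined by recursion on the dimension, so Tonelli's theorem peels off
    the first coordinate. *)
Lemma integral_leb_cons (R : realType) (n : nat)
    (f : n.+1.-tuple (measurableTypeR R) -> \bar R) :
  measurable_fun setT f -> (forall t, 0 <= f t)%E ->
  (\int[leb R n.+1]_t f t =
   \int[lebesgue_measure]_x \int[leb R n]_t f [tuple of x :: t])%E.
Proof.
move=> mf f0 /=.
pose tc (p : measurableTypeR R * n.-tuple (measurableTypeR R)) : n.+1.-tuple (measurableTypeR R) :=
  [the n.+1.-tuple _ of p.1 :: p.2].
have mtc : measurable_fun setT tc by exact: measurable_cons.
pose phi : {mfun _ >-> n.+1.-tuple (measurableTypeR R)} :=
  mfun_of mtc.
transitivity (\int[pushforward (lebesgue_measure \x leb R n) phi]_t f t)%E.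
  by apply: eq_measure_integral => A mA _.
rewrite (@ge0_integral_pushforward _ _ _ _ _ phi mtc)// preimage_setT.
rewrite fubini_tonelli1//; first exact: measurableT_comp.
by move=> x; exact: f0.
Qed.

(** One factor [c] for each application of Tonelli. The substitution may vary with
    the coordinate, as the reflection of the space in a point does. *)
Lemma subst_by_leb (R : realType) (c : R)
    (phi : nat -> measurableTypeR R -> measurableTypeR R) (n : nat)
    (f : n.-tuple (measurableTypeR R) -> \bar R) :
  0 <= c -> (forall i, subst_by c (phi i)) ->
  measurable_fun setT f -> (forall t, 0 <= f t)%E ->
  (\int[leb R n]_t f [tuple phi i (tnth t i) | i < n] =
   (c ^+ n)%:E * \int[leb R n]_t f t)%E.
Proof.
move=> c0; elim: n phi f => [|n IH] phi f hphi mf f0.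
  rewrite expr0 mul1e; apply: eq_integral => t _.
  by congr f; rewrite [t]tuple0; apply: val_inj => /=; apply: size0nil; rewrite size_map size_enum_ord.
have mF : measurable_fun setT (fun t : n.+1.-tuple (measurableTypeR R) =>
    [tuple phi i (tnth t i) | i < n.+1] : n.+1.-tuple (measurableTypeR R)).
  apply/measurable_fun_tnthP => i.
  rewrite (_ : _ \o _ = fun t => phi i (tnth t i)); last first.
    by apply/funext => t /=; rewrite tnth_mktuple.
  apply: measurableT_comp; first exact: (hphi i).1.
  exact: measurable_tnth.
rewrite integral_leb_cons//; last exact: measurableT_comp.
have mcons : measurable_fun setT (fun p : measurableTypeR R * n.-tuple (measurableTypeR R) =>
   [the n.+1.-tuple (measurableTypeR R) of p.1 :: p.2]) by exact: measurable_cons.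
pose g x := (\int[leb R n]_t f [tuple of x :: t])%E.
have mg : measurable_fun setT g.
  apply: (@measurable_fun_fubini_tonelli_F _ _ _ _ _ (leb R n)
    (fun p : measurableTypeR R * n.-tuple (measurableTypeR R) => f [the n.+1.-tuple _ of p.1 :: p.2])).
    exact: measurableT_comp.
  by move=> x; exact: f0.
have g0 x : (0 <= g x)%E by apply: integral_ge0 => t _.
transitivity (\int[lebesgue_measure]_x ((c ^+ n)%:E * g (phi 0%N x)))%E.
  apply: eq_integral => x _.
  rewrite /g -(IH (fun i => phi i.+1) (fun t => f [tuple of phi 0%N x :: t]))//; last first.
    apply: measurableT_comp => //.
    exact: (@measurable_cons _ _ _ _ (fun=> phi 0%N x) _ id).
  apply: eq_integral => t _; congr f; apply: eq_from_tnth => i.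
  rewrite tnth_mktuple; case: (unliftP ord0 i) => [j|] ->.
    by rewrite !tnthS tnth_mktuple.
  by rewrite !tnth0.
rewrite ge0_integralZl//.
- rewrite (hphi 0%N).2// muleA -EFinM -exprSr; congr (_ * _)%E.
  by rewrite integral_leb_cons.
- by apply: measurableT_comp => //; exact: (hphi 0%N).1.
- by rewrite lee_fin exprn_ge0.
Qed.

(** * Measurability and boxes in coordinates *)

Lemma rV_entry_le (R : realType) (n : nat) (x : 'rV[R]_n) i : `|x 0 i| <= `|x|.
Proof.
rewrite [leRHS]/Num.norm/= mx_normrE.
by have := @le_bigmax _ _ _ 0 (fun ij : 'I_1 * 'I_n => `|x ij.1 ij.2|) (0, i).
Qed.

Lemma rV_norm_lt (R : realType) (n : nat) (x : 'rV[R]_n) (e : R) : 0 < e ->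
  (forall i, `|x 0 i| < e) -> `|x| < e.
Proof.
move=> e0 h; rewrite [ltLHS]/Num.norm/= mx_normrE; apply/bigmax_ltP; split=> // -[i j] _.
by rewrite /= ord1.
Qed.

Lemma rV_norm_le (R : realType) (n : nat) (x : 'rV[R]_n) (e : R) : 0 <= e ->
  (forall i, `|x 0 i| <= e) -> `|x| <= e.
Proof.
move=> e0 h; rewrite [leLHS]/Num.norm/= mx_normrE; apply/bigmax_leP; split=> // -[i j] _.
by rewrite /= ord1.
Qed.

Lemma measurable_coord (R : realType) (n : nat) (i : 'I_n) :
  measurable_fun setT (fun t : n.-tuple (measurableTypeR R) => vec t 0 i : R).
Proof.
rewrite (_ : (fun t => _) = fun t => tnth t i); first exact: measurable_tnth.
by apply/funext => t; rewrite mxE.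
Qed.

(** The cubes with rational centre and radius [1/(m+1)] form a countable base,
    so open sets lie in the product sigma-algebra. *)
Lemma open_measurable_vec (R : realType) (n : nat) (O : set 'rV[R]_n) :
  open O -> measurable (@vec R n @^-1` O).
Proof.
move=> oO.
pose ctr (q : n.-tuple rat) : 'rV[R]_n := \row_i ratr (tnth q i).
pose cube (c : n.-tuple rat * nat) : set (n.-tuple (measurableTypeR R)) :=
  \big[setI/setT]_(i < n) [set t | `|vec t 0 i - ctr c.1 0 i| < c.2.+1%:R^-1].
have cubeP c t : cube c t <-> forall i, `|vec t 0 i - ctr c.1 0 i| < c.2.+1%:R^-1.
  rewrite /cube -bigcap_seq; split=> [h i|h i _]; last exact: h.
  by apply: (h i); rewrite /= mem_index_enum.
pose F c := if `[< cube c `<=` @vec R n @^-1` O >] then cube c else set0.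
rewrite (_ : _ @^-1` _ = \bigcup_c F c); last first.
  apply/seteqP; split => [t Ot|t [c _]]; last first.
    by rewrite /F; case: asboolP => // h; exact: h.
  have /nbhs_ballP[e /= e0 eO] : nbhs (vec t) O by exact: open_nbhs_nbhs.
  have e20 : 0 < e / 2 by rewrite divr_gt0.
  have [m hm] : exists m : nat, m.+1%:R^-1 < e / 2.
    exists (Num.truncn ((e / 2)^-1)).
    by rewrite invf_plt ?posrE//; exact: truncnS_gt.
  have m0 : 0 < m.+1%:R^-1 :> R by rewrite invr_gt0.
  have hq i : {q : rat | `|vec t 0 i - ratr q| < m.+1%:R^-1}.
    apply: cid.
    have /rat_in_itvoo[q] : vec t 0 i - m.+1%:R^-1 < vec t 0 i + m.+1%:R^-1.
      by rewrite ltrBlDr -addrA ltrDl addr_gt0.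
    rewrite in_itv/= => /andP[h1 h2]; exists q.
    by rewrite ltr_norml; apply/andP; split; move: h1 h2; set y := ratr q; set d := _^-1; set x := vec t 0 i; lra.
  pose q := [tuple sval (hq i) | i < n].
  have cq : cube (q, m) t.
    apply/cubeP => i /=; have -> : ctr q 0 i = ratr (sval (hq i)) by rewrite mxE tnth_mktuple.
    exact: (svalP (hq i)).
  exists (q, m) => //; rewrite /F asboolT// => s /cubeP sc; apply: eO.
  rewrite -ball_normE /=; apply: rV_norm_lt => // i.
  have /= := sc i; have /= := (cubeP _ _).1 cq i; rewrite !mxE !ltr_norml => /andP[a1 a2] /andP[b1 b2].
  by apply/andP; split; move: hm a1 a2 b1 b2; set d := _^-1; lra.
apply: countable_bigcupT_measurable => [|c]; first exact: countableP.
rewrite /F; case: ifP => // _; apply: bigsetI_measurable => i _.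
rewrite (_ : [set t | _] = (fun t => `|vec t 0 i - ctr c.1 0 i|) @^-1` `]-oo, c.2.+1%:R^-1[%classic); last first.
  by apply/seteqP; split => s /=; rewrite in_itv/=.
rewrite -[X in measurable X]setTI.
have : measurable_fun setT (fun t : n.-tuple (measurableTypeR R) => `|vec t 0 i - ctr c.1 0 i|).
  apply: measurableT_comp => //; apply: measurable_funB => //; exact: measurable_coord.
by move=> /(_ measurableT); apply.
Qed.

Lemma continuous_measurable_vec (R : realType) (n : nat) (f : 'rV[R]_n -> R) :
  continuous f -> measurable_fun setT (f \o @vec R n).
Proof.
move=> cf; apply: (measurability _ (RGenOInfty.measurableE R)) => _ [_ [x ->] <-].
rewrite setTI comp_preimage; apply: open_measurable_vec.
by apply: open_comp => //; exact: interval_open.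
Qed.

(** Boxes serve twice: they bound the mass of the mollifier kernel from both sides,
    and they carry the dominating functions for mollified integrals. *)
Lemma leb_box (R : realType) (n : nat) (r : R) : 0 <= r ->
  measurable [set t : n.-tuple (measurableTypeR R) | forall i, `|vec t 0 i| <= r] /\
  leb R n [set t | forall i, `|vec t 0 i| <= r] = ((r *+ 2) ^+ n)%:E.
Proof.
move=> r0; elim: n => [|n [IHm IH]].
  rewrite (_ : [set t | _] = setT); last by apply/seteqP; split=> // t _ [].
  by split => //=; rewrite diracT expr0.
have E : [set t : n.+1.-tuple (measurableTypeR R) | forall i, `|vec t 0 i| <= r] =
  [set t | `|vec t 0 ord0| <= r] `&` (fun t : n.+1.-tuple (measurableTypeR R) => [tuple of behead t]) @^-1` [set t | forall i, `|vec t 0 i| <= r].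
  apply/seteqP; split => t /=.
    move=> h; split=> // i; have := h (lift ord0 i).
    by rewrite !mxE [in X in X -> _](tuple_eta t) tnthS.
  move=> [h0 hS] i; case: (unliftP ord0 i) => [j|] -> //.
  by have := hS j; rewrite !mxE [in X in _ -> X](tuple_eta t) tnthS.
have L : lebesgue_measure ([set x | `|x| <= r] : set R) = (r *+ 2)%:E.
  rewrite (_ : [set x | _] = `[-r, r]%classic); last first.
    by apply/seteqP; split => x /=; rewrite in_itv/= ler_norml.
  rewrite (lebesgue_measure_itv) /= lte_fin; case: ifP => [_|/negbT].
    by rewrite -EFinB opprK -mulr2n.
  rewrite -leNgt => h; have -> : r = 0 by apply/eqP; rewrite eq_le r0 andbT; lra.
  by rewrite mul0rn.
have mI : measurable [set x : measurableTypeR R | `|x| <= r].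
  rewrite (_ : [set x | _] = `[-r, r]%classic) //.
  by apply/seteqP; split => x /=; rewrite in_itv/= ler_norml.
have mS : measurable [set t : n.+1.-tuple (measurableTypeR R) | forall i, `|vec t 0 i| <= r].
  rewrite E; apply: measurableI.
    have := @measurable_coord R n.+1 ord0 measurableT _ mI.
    by rewrite setTI.
  have := @measurable_behead _ (measurableTypeR R) n measurableT _ IHm.
  by rewrite setTI.
split=> //.
rewrite /= /leb_step /pushforward.
rewrite (_ : _ @^-1` _ = [set x | `|x| <= r] `*` [set t | forall i, `|vec t 0 i| <= r]); last first.
  apply/seteqP; split => -[x t] /= h.
    split; first by have := h ord0; rewrite mxE tnth0.
    by move=> i; have := h (lift ord0 i); rewrite !mxE tnthS.
  move=> i; case: (unliftP ord0 i) => [j|] ->.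
    by have := h.2 j; rewrite !mxE tnthS.
  by rewrite mxE tnth0; exact: h.1.
rewrite product_measure1E// [X in (_ * X)%E]IH exprS EFinM; congr (_ * _)%E.
exact: L.
Qed.

(** * The mollifier is a probability density *)

Lemma dot_ge0 (R : realType) (n : nat) (x : 'rV[R]_n) : 0 <= dot x x.
Proof. by apply: sumr_ge0 => i _; rewrite -expr2 sqr_ge0. Qed.

Lemma enorm_sq (R : realType) (n : nat) (x : 'rV[R]_n) : enorm x ^+ 2 = dot x x.
Proof. by rewrite sqr_sqrtr// dot_ge0. Qed.

Lemma enorm_ltE (R : realType) (n : nat) (x : 'rV[R]_n) (r : R) : 0 <= r ->
  (enorm x < r) = (dot x x < r ^+ 2).
Proof.
move=> r0; rewrite -enorm_sq ltr_pXn2r// nnegrE //; exact: sqrtr_ge0.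
Qed.

Lemma dot_entry_le (R : realType) (n : nat) (x : 'rV[R]_n) i : x 0 i ^+ 2 <= dot x x.
Proof.
rewrite /dot (bigD1 i)//= -expr2 lerDl sumr_ge0// => j _.
by rewrite -expr2 sqr_ge0.
Qed.

Section kernel_facts.
Variables (R : realType) (n : nat).
Notation T := (n.-tuple (measurableTypeR R)).
Notation ker := (@mollifier_kernel R n).

Lemma ker_ge0 (z : 'rV[R]_n) : 0 <= ker z.
Proof. by rewrite /mollifier_kernel; case: ifP => // _; exact: expR_ge0. Qed.

Lemma ker_le1 (z : 'rV[R]_n) : ker z <= 1.
Proof.
rewrite /mollifier_kernel; case: ifP => // z1; rewrite -[leRHS]expR0 ler_expR.
rewrite lerNl oppr0 invr_ge0 subr_ge0 enorm_sq.
by move: z1; rewrite enorm_ltE// expr1n => /ltW.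
Qed.

Lemma ker_supp (z : 'rV[R]_n) : ker z != 0 -> forall i, `|z 0 i| <= 1.
Proof.
rewrite /mollifier_kernel; case: ifP => [|_]; last by rewrite eqxx.
rewrite enorm_ltE// expr1n => z1 _ i.
have := le_lt_trans (dot_entry_le z i) z1; rewrite expr2 ler_norml; set y := z 0 i => h.
by apply/andP; split; nra.
Qed.

Lemma ker_lb (z : 'rV[R]_n) : dot z z <= 2^-1 -> expR (- 2) <= ker z.
Proof.
move=> h; rewrite /mollifier_kernel enorm_ltE// expr1n enorm_sq.
have -> : dot z z < 1 by lra.
rewrite ler_expR lerN2 -[leRHS]invrK lef_pV2 ?posrE//; lra.
Qed.

Lemma measurable_ker (a : R) :
  measurable_fun setT (fun t : T => ker (a *: vec t)).
Proof.
have md : measurable_fun setT (fun t : T => dot (a *: vec t) (a *: vec t)).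
  apply: measurable_sum => i; apply: measurable_funM;
    (under eq_fun do rewrite mxE); apply: measurable_funM => //; exact: measurable_coord.
rewrite (_ : (fun t => _) = fun t : T => if dot (a *: vec t) (a *: vec t) < 1 then
   expR (- (1 - dot (a *: vec t) (a *: vec t)) `^ (-1)) else 0); last first.
  apply/funext => t; rewrite /mollifier_kernel enorm_ltE// expr1n enorm_sq.
  by case: ifP => // h; rewrite powR_inv1// subr_ge0 ltW.
apply: measurable_fun_ifT => //.
  exact: measurable_fun_ltr.
apply: (measurableT_comp (@measurable_expR R)).
apply: (measurableT_comp (@oppr_measurable R setT)).
apply: (measurableT_comp (@measurable_powR R (-1))).
exact: measurable_funB.
Qed.

(** The kernel lies below the indicator of the box of half-width [1], and above
    [e^-2] times that of the box of half-width [1/(2(n+1))], on which the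
    squared norm is at most [1/2]. Hence normalising it is legitimate. *)
Lemma ker_mass : exists2 c : R, 0 < c &
  (\int[leb R n]_t (ker (vec t))%:E = c%:E)%E.
Proof.
have mk : measurable_fun setT (fun t : T => (ker (vec t))%:E).
  apply/measurable_EFinP; under eq_fun do rewrite -[vec _]scale1r.
  exact: measurable_ker.
have [mB LB] := @leb_box R n 1 ler01.
pose r : R := (2 * n.+1%:R)^-1.
have r0 : 0 < r by rewrite invr_gt0 mulr_gt0.
have [mb Lb] := @leb_box R n r (ltW r0).
have up : (\int[leb R n]_t (ker (vec t))%:E <= ((1 *+ 2) ^+ n)%:E)%E.
  rewrite -LB -[X in (_ <= _ _ X)%E]setIT -integral_indic//.
  apply: ge0_le_integral => //.
  - by move=> t _; rewrite lee_fin ker_ge0.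
  - by apply/measurable_EFinP; exact: measurable_indic.
  - move=> t _; rewrite lee_fin indicE; have [_|] := boolP (_ \in _).
      exact: ker_le1.
    rewrite notin_setE => h; rewrite leNgt; apply/negP => k0; apply: h; apply: ker_supp.
    by rewrite gt_eqF.
have lo : ((expR (-2) * (r *+ 2) ^+ n)%:E <= \int[leb R n]_t (ker (vec t))%:E)%E.
  rewrite EFinM -Lb -[X in (_ * _ _ X <= _)%E]setIT -integral_indic// -ge0_integralZl//.
  - apply: ge0_le_integral => //.
    + by apply: measurable_funeM; apply/measurable_EFinP; exact: measurable_indic.
    + move=> t _; rewrite -EFinM lee_fin indicE; have [|_] := boolP (_ \in _); last by rewrite mulr0 ker_ge0.
      rewrite inE /= => h; rewrite mulr1; apply: ker_lb.
      apply: (@le_trans _ _ (\sum_(i < n) r ^+ 2)).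
        apply: ler_sum => i _; rewrite -expr2 -[leLHS]real_normK ?num_real//.
        by rewrite ler_pXn2r ?nnegrE// ltW.
      rewrite sumr_const card_ord -mulr_natr /r expr2 invfM.
      have n0 : 0 < n.+1%:R :> R by [].
      have e1 : n.+1%:R^-1 * n%:R <= 1 :> R by rewrite mulrC ler_pdivrMr// mul1r ler_nat.
      have e2 : n.+1%:R^-1 <= 1 :> R by rewrite invf_le1// ler1n.
      have e3 : 0 <= n.+1%:R^-1 :> R by rewrite invr_ge0 ltW.
      have e4 : 0 <= n%:R :> R by [].
      have e5 : n.+1%:R^-1 * (n.+1%:R^-1 * n%:R) <= 1 :> R by rewrite mulr_ile1// mulr_ge0.
      move: e5; set m := n.+1%:R^-1; set k := n%:R; nra.
  - by apply/measurable_EFinP; exact: measurable_indic.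
have fn : (\int[leb R n]_t (ker (vec t))%:E)%E \is a fin_num.
  rewrite ge0_fin_numE; first by rewrite (le_lt_trans up)// ltry.
  by apply: integral_ge0 => t _; rewrite lee_fin ker_ge0.
exists (fine (\int[leb R n]_t (ker (vec t))%:E)%E); last by rewrite fineK.
rewrite -lte_fin fineK//; apply: lt_le_trans lo.
by rewrite lte_fin mulr_gt0 ?expR_gt0// exprn_gt0// pmulrn_lgt0.
Qed.

Variable gamma : R.
Hypothesis hgamma : 0 < gamma <= 1.

Lemma gamma_gt0 : 0 < gamma. Proof. by case/andP: hgamma. Qed.

Lemma mollifier_ge0 (z : 'rV[R]_n) : 0 <= mollifier gamma z.
Proof.
rewrite /mollifier !mulr_ge0 ?ker_ge0// invr_ge0 ?exprn_ge0 ?(ltW gamma_gt0)//.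
by apply: Rintegral_ge0 => t _; exact: ker_ge0.
Qed.

Lemma mollifier_bounded : exists B : R, forall z : 'rV[R]_n, mollifier gamma z <= B.
Proof.
exists ((\int[leb R n]_t mollifier_kernel (vec t))^-1 * gamma ^- n) => z.
rewrite /mollifier ler_piMr ?ker_le1// mulr_ge0 ?invr_ge0 ?exprn_ge0 ?(ltW gamma_gt0)//.
by apply: Rintegral_ge0 => t _; exact: ker_ge0.
Qed.

Lemma mollifier_supp (z : 'rV[R]_n) : mollifier gamma z != 0 -> forall i, `|z 0 i| <= 1.
Proof.
rewrite /mollifier mulf_eq0 negb_or => /andP[_ /ker_supp h] i.
have := h i; rewrite mxE normrM gtr0_norm ?invr_gt0 ?gamma_gt0// ler_pdivrMl ?gamma_gt0// mulr1.
by move=> h'; case/andP: hgamma => _; exact: le_trans.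
Qed.

Lemma measurable_mollifier :
  measurable_fun setT (fun t : T => mollifier gamma (vec t)).
Proof. by apply: measurable_funM => //; exact: measurable_ker. Qed.

Lemma mollifier_mass : (\int[leb R n]_t (mollifier gamma (vec t))%:E = 1)%E.
Proof.
have [c c0 hc] := ker_mass.
have g0 := gamma_gt0.
have -> : (fun t : T => (mollifier gamma (vec t))%:E) =
    (fun t => ((c^-1 * gamma ^- n)%:E * (ker (gamma^-1 *: vec t))%:E)%E).
  by apply/funext => t; rewrite -EFinM /mollifier /Rintegral hc.
rewrite ge0_integralZl//; first last.
- by rewrite lee_fin mulr_ge0// invr_ge0 ?exprn_ge0// ltW.
- by move=> t _; rewrite lee_fin ker_ge0.
- by apply/measurable_EFinP; exact: measurable_ker.
have E := @subst_by_leb R gamma (fun=> fun x => gamma^-1 * x) n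
  (fun t => (ker (vec t))%:E) (ltW g0).
rewrite hc in E.
rewrite [X in (_ * X)%E](_ : _ = (gamma ^+ n)%:E * c%:E)%E; last first.
  rewrite -E.
  - apply: eq_integral => t _; congr (ker _)%:E.
    by apply/rowP => i; rewrite !mxE tnth_mktuple.
  - by move=> _; rewrite -{1}[gamma]invrK; apply: subst_by_dilation; rewrite invr_gt0.
  - apply/measurable_EFinP; under eq_fun do rewrite -[vec _]scale1r.
    exact: measurable_ker.
  - by move=> t; rewrite lee_fin ker_ge0.
rewrite -!EFinM; congr _%:E.
have gn : gamma ^+ n != 0 by rewrite expf_neq0// gt_eqF.
by field; rewrite gn gt_eqF.
Qed.

End kernel_facts.

(** * Mollification preserves two-sided quadratic convexity *)

Section dot_algebra.
Variables (R : realType) (n : nat).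
Implicit Types x y z : 'rV[R]_n.

Lemma dotC x y : dot x y = dot y x.
Proof. by apply: eq_bigr => i _; rewrite mulrC. Qed.

Lemma dotDl x y z : dot (x + y) z = dot x z + dot y z.
Proof. by rewrite -big_split; apply: eq_bigr => i _; rewrite mxE mulrDl. Qed.

Lemma dotDr x y z : dot z (x + y) = dot z x + dot z y.
Proof. by rewrite dotC dotDl ![dot _ z]dotC. Qed.

Lemma dotZl (a : R) x z : dot (a *: x) z = a * dot x z.
Proof. by rewrite mulr_sumr; apply: eq_bigr => i _; rewrite mxE mulrA. Qed.

Lemma dotZr (a : R) x z : dot z (a *: x) = a * dot z x.
Proof. by rewrite dotC dotZl dotC. Qed.

Lemma dotNl x z : dot (- x) z = - dot x z.
Proof. by rewrite -scaleN1r dotZl mulN1r. Qed.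

Lemma dotNr x z : dot z (- x) = - dot z x.
Proof. by rewrite dotC dotNl dotC. Qed.

Lemma dotBl x y z : dot (x - y) z = dot x z - dot y z.
Proof. by rewrite dotDl dotNl. Qed.

Lemma dotBr x y z : dot z (x - y) = dot z x - dot z y.
Proof. by rewrite dotDr dotNr. Qed.

Lemma dot0l z : dot 0 z = 0.
Proof. by rewrite -(scale0r 0) dotZl mul0r. Qed.

Lemma dot0r z : dot z 0 = 0.
Proof. by rewrite dotC dot0l. Qed.

End dot_algebra.

Definition dotE := (dotDl, dotDr, dotBl, dotBr, dotZl, dotZr, dotNl, dotNr).

(** Convexity of [F - lo/2 |.|^2] and of [hi/2 |.|^2 - F], stated on [F] itself:
    the gap depends on [a - b] only, so the property passes to translates and to
    averages of translates. *)
Definition quad_convex (R : realType) (n : nat) (lo hi : R) (F : 'rV[R]_n -> R) : Prop :=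
  forall (a b : 'rV[R]_n) (s : R), 0 <= s <= 1 ->
    let defect := s * F a + (1 - s) * F b - F (s *: a + (1 - s) *: b) in
    let gap := s * (1 - s) * dot (a - b) (a - b) in
    lo / 2 * gap <= defect <= hi / 2 * gap.

Lemma admissible_quad_convex (R : realType) (n : nat) (lo hi : R) (H : 'rV[R]_n -> R) :
  admissible lo hi H -> quad_convex lo hi H.
Proof.
move=> [_ cl ch _ _] a b s s01 /=.
have /andP[s0 s1] := s01.
have := cl (Itv01 s0 s1) a b (mem_setT _) (mem_setT _).
have := ch (Itv01 s0 s1) a b (mem_setT _) (mem_setT _).
rewrite !convRE /conv/= /unstable.onem !enorm_sq !dotE => h1 h2.
rewrite (dotC b a) in h1 h2 *.
by apply/andP; split; lra.
Qed.

Section mollify_facts.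
Variables (R : realType) (n : nat) (gamma : R) (H : 'rV[R]_n -> R).
Hypothesis hgamma : 0 < gamma <= 1.
Hypothesis cH : continuous H.
Hypothesis H0 : forall p, 0 <= H p.
Notation T := (n.-tuple (measurableTypeR R)).
Notation eta := (@mollifier R n gamma).

Lemma measurable_reflected (p : 'rV[R]_n) :
  measurable_fun setT (fun t : T => H (p - vec t)).
Proof.
apply: (@continuous_measurable_vec R n (fun x => H (p - x))) => x.
apply: (@continuous_comp _ _ _ (fun x : 'rV[R]_n => p - x) H); last exact: cH.
exact: (@continuousB _ _ _ (fun=> p) id x (@cst_continuous _ _ p x) (fun A hA => hA)).
Qed.

(** Moves the dependence on [p] from the kernel to [H], so that convexity of the
    functions [H (. - y)] can be averaged. *)
Lemma mollifyE (p : 'rV[R]_n) :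
  mollify gamma H p = \int[leb R n]_t (eta (vec t) * H (p - vec t)).
Proof.
rewrite /mollify /Rintegral; congr fine.
pose f (t : T) : \bar R := (eta (vec t) * H (p - vec t))%:E.
have mf : measurable_fun setT f.
  apply/measurable_EFinP; apply: measurable_funM.
    exact: measurable_mollifier.
  exact: measurable_reflected.
have f0 t : (0 <= f t)%E by rewrite lee_fin mulr_ge0// mollifier_ge0.
pose phi (i : nat) (x : measurableTypeR R) : measurableTypeR R :=
  oapp (p 0) 0 (insub i) - x.
have := @subst_by_leb R 1 phi n f ler01 (fun i => subst_by_reflection _) mf f0.
rewrite expr1n mul1e => <-.
apply: eq_integral => t _; rewrite /f.
have -> : vec [tuple phi i (tnth t i) | i < n] = p - vec t.
  by apply/rowP => i; rewrite !mxE tnth_mktuple /phi valK.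
by rewrite opprB addrCA subrr addr0.
Qed.

(** The mollifier is bounded and vanishes outside the unit box, on which the
    continuous function [H (p - .)] attains a maximum. *)
Lemma mollify_integrable (p : 'rV[R]_n) :
  (leb R n).-integrable setT (fun t : T => (eta (vec t) * H (p - vec t))%:E).
Proof.
have [mB LB] := @leb_box R n 1 ler01.
set box := [set t | _] in mB LB.
have [B hB] := @mollifier_bounded R n gamma hgamma.
have B0 : 0 <= B by apply: le_trans (hB 0); exact: mollifier_ge0.
have [c _ hc] : exists2 c : 'rV[R]_n, c \in [set x : 'rV[R]_n | `|x| <= 1] &
    forall x, x \in [set x : 'rV[R]_n | `|x| <= 1] -> H (p - x) <= H (p - c).
  apply: (@EVT_max_rV R n (fun x => H (p - x))).
  - by exists 0; rewrite /= normr0.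
  - apply: bounded_closed_compact.
      by exists 1; split=> [|M M1 x /= x1]; rewrite ?num_real// (le_trans x1)// ltW.
    rewrite (_ : [set x | _] = (fun x : 'rV[R]_n => `|x|) @^-1` [set r | r <= 1])//.
    apply: closed_comp; last exact: closed_le.
    by move=> x _; exact: norm_continuous.
  - apply: continuous_subspaceT => x.
    apply: (@continuous_comp _ _ _ (fun x : 'rV[R]_n => p - x) H); last exact: cH.
    exact: (@continuousB _ _ _ (fun=> p) id x (@cst_continuous _ _ p x) (fun A hA => hA)).
apply: (@le_integrable _ _ _ (leb R n) setT measurableT _ (fun t => ((B * H (p - c))%:E * (\1_box t)%:E)%E)) => //.
- apply/measurable_EFinP; apply: measurable_funM.
    exact: measurable_mollifier.
  exact: measurable_reflected.
- move=> t _; rewrite -EFinM /= lee_fin !ger0_norm; last 2 first.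
  + by rewrite !mulr_ge0.
  + by rewrite mulr_ge0// mollifier_ge0.
  have [->|e0] := eqVneq (eta (vec t)) 0; first by rewrite mul0r !mulr_ge0.
  have tb := mollifier_supp hgamma e0.
  rewrite indicE mem_set// mulr1 ler_pM ?mollifier_ge0//.
  by apply: hc; rewrite inE /=; exact: rV_norm_le.
- apply: integrableZl => //.
  apply/integrableP; split; first by apply/measurable_EFinP; exact: measurable_indic.
  under eq_integral do rewrite gee0_abs ?lee_fin//.
  by rewrite integral_indic// setIT [X in (X < _)%E]LB ltry.
Qed.

Lemma mollifier_integrable (k : R) :
  (leb R n).-integrable setT (fun t : T => (eta (vec t) * k)%:E).
Proof.
under eq_fun do rewrite mulrC EFinM.
apply: integrableZl => //; apply/integrableP; split.
  by apply/measurable_EFinP; exact: measurable_mollifier.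
under eq_integral do rewrite gee0_abs ?lee_fin ?mollifier_ge0//.
by rewrite mollifier_mass// ltry.
Qed.

Lemma mollifier_average (k : R) : \int[leb R n]_t (eta (vec t) * k) = k.
Proof.
rewrite RintegralZr//; last by have := mollifier_integrable 1; under eq_fun do rewrite mulr1.
by rewrite /Rintegral mollifier_mass//= mul1r.
Qed.

(** The defect of an average is the average of the defects, and the gap is the
    same for all translates; the mollifier has mass [1]. *)
Lemma mollify_quad_convex (lo hi : R) : quad_convex lo hi H ->
  quad_convex lo hi (mollify gamma H).
Proof.
move=> hH a b s s01; cbv zeta; rewrite !mollifyE.
have zE z : s *: a + (1 - s) *: b - z = s *: (a - z) + (1 - s) *: (b - z).
  by rewrite !scalerBr addrACA -opprD -scalerDl addrCA subrr addr0 scale1r.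
have E : s * (\int[leb R n]_t (eta (vec t) * H (a - vec t))) +
  (1 - s) * (\int[leb R n]_t (eta (vec t) * H (b - vec t))) -
  \int[leb R n]_t (eta (vec t) * H (s *: a + (1 - s) *: b - vec t)) =
  \int[leb R n]_t (eta (vec t) * (s * H (a - vec t) + (1 - s) * H (b - vec t)
     - H (s *: a + (1 - s) *: b - vec t))).
  have ia := integrableZl measurableT s (mollify_integrable a).
  have ib := integrableZl measurableT (1 - s) (mollify_integrable b).
  rewrite -!RintegralZl//; try exact: mollify_integrable.
  rewrite -RintegralD// -RintegralB//; last 2 first.
  - exact: (eq_integrable measurableT _ _ _ (integrableD measurableT ia ib)).
  - exact: mollify_integrable.
  by apply: eq_Rintegral => t _; ring.
rewrite {}E.
have iD : (leb R n).-integrable setT (fun t : T => (eta (vec t) * (s * H (a - vec t) + (1 - s) * H (b - vec t)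
     - H (s *: a + (1 - s) *: b - vec t)))%:E).
  have ia := integrableZl measurableT s (mollify_integrable a).
  have ib := integrableZl measurableT (1 - s) (mollify_integrable b).
  have ic := mollify_integrable (s *: a + (1 - s) *: b).
  have := integrableB measurableT (integrableD measurableT ia ib) ic.
  apply: (eq_integrable measurableT) => t _ /=.
  by rewrite -!EFinM -!EFinD; congr _%:E; ring.
have gapE z : dot (a - z - (b - z)) (a - z - (b - z)) = dot (a - b) (a - b).
  by rewrite opprB addrA subrK.
apply/andP; split.
  rewrite -[leLHS]mollifier_average; apply: le_Rintegral => //.
    exact: mollifier_integrable.
  move=> t _; apply: ler_wpM2l; first exact: mollifier_ge0.
  by rewrite zE -(gapE (vec t)); have /andP[] := hH (a - vec t) (b - vec t) s s01.
rewrite -[leRHS]mollifier_average; apply: le_Rintegral => //.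
  exact: mollifier_integrable.
move=> t _; apply: ler_wpM2l; first exact: mollifier_ge0.
by rewrite zE -(gapE (vec t)); have /andP[] := hH (a - vec t) (b - vec t) s s01.
Qed.

End mollify_facts.

Lemma regularized_quad_convex (R : realType) (n : nat) (lo hi gamma : R)
    (H : 'rV[R]_n -> R) (p : 'rV[R]_n) :
  0 < gamma <= 1 -> admissible lo hi H -> quad_convex lo hi (regularized gamma H p).
Proof.
move=> hg hH a b s s01; have [cH _ _ _ H0] := hH.
have := mollify_quad_convex hg cH H0 (admissible_quad_convex hH) (a + p) (b + p) s01.
cbv zeta; rewrite /regularized.
have -> : s *: (a + p) + (1 - s) *: (b + p) = s *: a + (1 - s) *: b + p.
  by rewrite !scalerDr addrACA -scalerDl addrCA subrr addr0 scale1r.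
have -> : a + p - (b + p) = a - b by rewrite opprD addrACA subrr addr0.
suff -> (x y z w : R) : s * (x - w) + (1 - s) * (y - w) - (z - w) = s * x + (1 - s) * y - z.
  by [].
by ring.
Qed.

(** * Gradients of quadratically convex functions *)

(** A quadratic remainder determines the linear part; this is what makes the slopes
    constructed below linear in the direction. *)
Lemma slope_unique (R : realFieldType) (f : R -> R) (d d' K K' : R) :
  (forall t, `|f t - t * d| <= K * t ^+ 2) ->
  (forall t, `|f t - t * d'| <= K' * t ^+ 2) -> d = d'.
Proof.
move=> h h'; apply/eqP/negPn/negP => dd.
pose e := `|d - d'|; have e0 : 0 < e by rewrite normr_gt0 subr_eq0.
have K0 : 0 <= K by have := le_trans (normr_ge0 _) (h 1); rewrite expr1n mulr1.
have K0' : 0 <= K' by have := le_trans (normr_ge0 _) (h' 1); rewrite expr1n mulr1.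
pose t := e / (K + K' + 1).
have t0 : 0 < t by rewrite divr_gt0// ltr_wpDl// addr_ge0.
have : `|t * d - t * d'| <= (K + K') * t ^+ 2.
  have -> : t * d - t * d' = (f t - t * d') - (f t - t * d) by ring.
  by rewrite (le_trans (ler_normB _ _))// mulrDl addrC lerD.
rewrite -mulrBr normrM (gtr0_norm t0) -/e expr2 mulrCA ler_pM2l//.
apply/negP; rewrite -ltNge.
rewrite /t mulrA ltr_pdivrMr ?ltr_wpDl ?addr_ge0//.
by rewrite mulrC ltr_pM2l// ltrDl.
Qed.

Lemma cvg_dot (R : realType) (n : nat) (T : Type) (A : set_system T) (FA : Filter A)
    (f g : T -> 'rV[R]_n) (a b : 'rV[R]_n) :
  (forall i, f x 0 i @[x --> A] --> a 0 i) ->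
  (forall i, g x 0 i @[x --> A] --> b 0 i) ->
  dot (f x) (g x) @[x --> A] --> dot a b.
Proof.
move=> fa gb; apply: cvg_big => [|i _]; first exact: add_continuous.
exact: cvgM.
Qed.

Lemma cvg_affine_pair (R : realType) (T : Type) (A : set_system T) (FA : Filter A)
    (f g : T -> R) (a k : R) :
  f @ A --> (0 : R) -> g @ A --> (0 : R) -> (fun x => a + f x + k * g x) @ A --> a.
Proof.
move=> f0 g0.
have E : a = a + 0 + k * 0 by ring.
rewrite [X in _ --> X]E; apply: cvgD.
  by apply: cvgD => //; exact: cvg_cst.
by apply: cvgM => //; exact: cvg_cst.
Qed.

Section quad_convex_gradient.
Variables (R : realType) (n : nat) (lo hi : R) (F : 'rV[R]_n -> R).
Hypotheses (lo0 : 0 <= lo) (lohi : lo <= hi) (hF : quad_convex lo hi F).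
Implicit Types p q x y : 'rV[R]_n.

Let hi0 : 0 <= hi. Proof. exact: le_trans lohi. Qed.

(** Convexity at [p], an intermediate point of [p - s x] and [p + t x], divided by
    its weight: right and left difference quotients differ by [O(s + t)]. *)
Lemma secant_gap p x (s t : R) : 0 < s -> 0 < t ->
  lo / 2 * ((s + t) * dot x x) <=
  (F (p + t *: x) - F p) / t + (F (p - s *: x) - F p) / s
  <= hi / 2 * ((s + t) * dot x x).
Proof.
move=> s0 t0; have st0 : 0 < s + t by rewrite addr_gt0.
pose th := s / (s + t).
have th01 : 0 <= th <= 1.
  apply/andP; split; rewrite /th; first by rewrite divr_ge0// ltW.
  by rewrite ler_pdivrMr// mul1r lerDl ltW.
have := hF (p + t *: x) (p - s *: x) th01; cbv zeta.
have -> : th *: (p + t *: x) + (1 - th) *: (p - s *: x) = p.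
  apply/rowP => i; rewrite !mxE /th; field; exact: lt0r_neq0.
have -> : p + t *: x - (p - s *: x) = (s + t) *: x.
  by rewrite opprB addrC addrA subrK scalerDl.
rewrite dotZl dotZr.
have -> : th * (1 - th) * ((s + t) * ((s + t) * dot x x)) = s * t * dot x x.
  by rewrite /th; field; exact: lt0r_neq0.
have -> : th * F (p + t *: x) + (1 - th) * F (p - s *: x) - F p =
   s * t / (s + t) * ((F (p + t *: x) - F p) / t + (F (p - s *: x) - F p) / s).
  by rewrite /th; field; rewrite !lt0r_neq0.
have c0 : 0 < s * t / (s + t) by rewrite divr_gt0// mulr_gt0.
rewrite (_ : lo / 2 * (s * t * dot x x) = s * t / (s + t) * (lo / 2 * ((s + t) * dot x x))); last first.
  by field; rewrite lt0r_neq0.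
rewrite (_ : hi / 2 * (s * t * dot x x) = s * t / (s + t) * (hi / 2 * ((s + t) * dot x x))); last first.
  by field; rewrite lt0r_neq0.
by rewrite !ler_pM2l.
Qed.

(** The slope is the supremum of the left difference quotients. By [secant_gap]
    these are below the right ones, and letting one of the two increments tend to
    [0] leaves the quadratic remainder in the other. *)
Lemma directional_slope p x : exists d : R, forall t : R,
  lo / 2 * (t ^+ 2 * dot x x) <= F (p + t *: x) - F p - t * d
  <= hi / 2 * (t ^+ 2 * dot x x).
Proof.
have N0 := dot_ge0 x; set N := dot x x in N0 *.
pose Q (t : R) := (F (p + t *: x) - F p) / t.
have QE t : t != 0 -> F (p + t *: x) - F p = t * Q t.
  by move=> t0; rewrite /Q mulrC divfK.
have gap s t : 0 < s -> 0 < t ->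
    lo / 2 * ((s + t) * N) <= Q t - Q (- s) <= hi / 2 * ((s + t) * N).
  move=> s0 t0; have := secant_gap p x s0 t0.
  by rewrite /Q invrN mulrN opprK scaleNr.
pose S := [set Q (- s) | s in [set s : R | 0 < s]].
have Sub t : 0 < t -> ubound S (Q t).
  move=> t0 _ [s /= s0 <-]; have /andP[h _] := gap s t s0 t0.
  rewrite -subr_ge0; apply: le_trans h.
  by rewrite mulr_ge0 ?divr_ge0// mulr_ge0// addr_ge0 ?ltW.
have hS : has_sup S by split; [exists (Q (-1)), 1 => /=|exists (Q 1); exact: Sub].
pose d := sup S.
have dub s : 0 < s -> Q (- s) <= d by move=> s0; apply: sup_upper_bound => //; exists s.
have lim0 (a b k : R) : 0 <= k -> (forall s, 0 < s -> a <= b + k * s) -> a <= b.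
  move=> k0 h; rewrite leNgt; apply/negP => ba.
  have s0 : 0 < (a - b) / 2 / (k + 1) by rewrite !divr_gt0 ?subr_gt0// ltr_wpDl.
  have := h _ s0; apply/negP; rewrite -ltNge.
  have k1 : k + 1 != 0 by rewrite lt0r_neq0// ltr_wpDl.
  have hk : k / (k + 1) <= 1 by rewrite ler_pdivrMr ?ltr_wpDl// mul1r lerDl.
  rewrite (_ : k * _ = (a - b) / 2 * (k / (k + 1))); last by field.
  have : (a - b) / 2 * (k / (k + 1)) <= (a - b) / 2 by rewrite ler_piMr// divr_ge0// subr_ge0 ltW.
  by lra.
have hiN0 : 0 <= hi / 2 * N by rewrite mulr_ge0// divr_ge0.
have loN0 : 0 <= lo / 2 * N by rewrite mulr_ge0// divr_ge0.
have dle t : 0 < t -> d <= Q t - lo / 2 * (t * N).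
  move=> t0; apply: ge_sup; first by case: hS.
  move=> _ [s /= s0 <-]; have /andP[h _] := gap s t s0 t0.
  have : 0 <= lo / 2 * N * s by rewrite mulr_ge0// ltW.
  by move: h; nra.
have led t : 0 < t -> Q t - hi / 2 * (t * N) <= d.
  move=> t0; apply: (lim0 _ _ (hi / 2 * N)) => // s s0.
  have /andP[_ h] := gap s t s0 t0; have := dub s s0; move: h; nra.
exists d => t; have [->|t0] := eqVneq t 0.
  by rewrite scale0r addr0 expr0n/= !mul0r !mulr0 !subrr lexx.
rewrite QE// -mulrBr.
have [{}t0|{}t0|/eqP] := ltgtP t 0; last by rewrite (negbTE t0).
  have s0 : 0 < - t by rewrite oppr_gt0.
  have h1 : d <= Q t + hi / 2 * (- t * N).
    apply: (lim0 _ _ (hi / 2 * N)) => // u u0.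
    have := dle u u0; have /andP[_] := gap (- t) u s0 u0; rewrite opprK.
    have : 0 <= lo / 2 * N * u by rewrite mulr_ge0// ltW.
    nra.
  have h2 : Q t + lo / 2 * (- t * N) <= d.
    apply: (lim0 _ _ (hi / 2 * N)) => // u u0.
    have := led u u0; have /andP[+ _] := gap (- t) u s0 u0; rewrite opprK.
    have : 0 <= lo / 2 * N * u by rewrite mulr_ge0// ltW.
    nra.
  by apply/andP; split; nra.
have h1 := dle t t0; have h2 := led t t0.
by apply/andP; split; nra.
Qed.

Definition slope p x : R := sval (cid (directional_slope p x)).

Lemma slopeP p x (t : R) :
  lo / 2 * (t ^+ 2 * dot x x) <= F (p + t *: x) - F p - t * slope p x
  <= hi / 2 * (t ^+ 2 * dot x x).
Proof. exact: (svalP (cid (directional_slope p x))). Qed.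

Lemma slope_normP p x (t : R) :
  `|(F (p + t *: x) - F p) - t * slope p x| <= hi / 2 * dot x x * t ^+ 2.
Proof.
have /andP[h1 h2] := slopeP p x t; rewrite ger0_norm.
  by rewrite mulrAC -mulrA.
by apply: le_trans h1; apply: mulr_ge0; [exact: divr_ge0|rewrite mulr_ge0 ?dot_ge0 ?sqr_ge0].
Qed.

Lemma slopeZ p x (a : R) : slope p (a *: x) = a * slope p x.
Proof.
apply: (@slope_unique _ (fun t => F (p + t *: (a *: x)) - F p) _ _ _
  (hi / 2 * dot x x * a ^+ 2) (slope_normP p (a *: x))) => t.
have := slope_normP p x (t * a); rewrite scalerA exprMn => h.
by rewrite mulrA -[leRHS]mulrA [a ^+ 2 * _]mulrC.
Qed.

(** Convexity at the midpoint of [p + 2t x] and [p + 2t y] shows that the sum of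
    the slopes is a linear part for the direction [x + y] too. *)
Lemma slopeD p x y : slope p (x + y) = slope p x + slope p y.
Proof.
apply: (@slope_unique _ (fun t => F (p + t *: (x + y)) - F p) _ _ _
  (hi * (dot x x + dot y y) + hi / 2 * dot (x - y) (x - y))
  (slope_normP p (x + y))) => t.
have /andP[h1 h2] := slopeP p x (2 * t).
have /andP[h3 h4] := slopeP p y (2 * t).
have half : 0 <= (2^-1 : R) <= 1 by apply/andP; split; lra.
have := hF (p + (2 * t) *: x) (p + (2 * t) *: y) half; cbv zeta.
have -> : 2^-1 *: (p + (2 * t) *: x) + (1 - 2^-1) *: (p + (2 * t) *: y) = p + t *: (x + y).
  by apply/rowP => i; rewrite !mxE; field.
have -> : p + (2 * t) *: x - (p + (2 * t) *: y) = (2 * t) *: (x - y).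
  by apply/rowP => i; rewrite !mxE; ring.
rewrite dotZl dotZr => /andP[h5 h6].
have X0 := dot_ge0 x; have Y0 := dot_ge0 y; have Z0 := dot_ge0 (x - y).
move: h1 h2 h3 h4 h5 h6 X0 Y0 Z0.
move: (F _) (F _) (F _) (F _) (slope _ _) (slope _ _) (dot _ _) (dot _ _) (dot _ _) => A B C D dx dy X Y Z.
move=> h1 h2 h3 h4 h5 h6 Z0 Y0 X0.
have t2 : 0 <= t ^+ 2 := sqr_ge0 t.
have a1 : 0 <= lo * (t ^+ 2 * X) := mulr_ge0 lo0 (mulr_ge0 t2 X0).
have a2 : 0 <= lo * (t ^+ 2 * Y) := mulr_ge0 lo0 (mulr_ge0 t2 Y0).
have a3 : 0 <= lo * (t ^+ 2 * Z) := mulr_ge0 lo0 (mulr_ge0 t2 Z0).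
have b1 : 0 <= hi * (t ^+ 2 * X) := mulr_ge0 hi0 (mulr_ge0 t2 X0).
have b2 : 0 <= hi * (t ^+ 2 * Y) := mulr_ge0 hi0 (mulr_ge0 t2 Y0).
have b3 : 0 <= hi * (t ^+ 2 * Z) := mulr_ge0 hi0 (mulr_ge0 t2 Z0).
by rewrite ler_norml; apply/andP; split; lra.
Qed.

Lemma slope0 p : slope p 0 = 0.
Proof. by rewrite -(scale0r 0) slopeZ mul0r. Qed.

Lemma slope_derive p x : is_derive p x F (slope p x).
Proof.
have h : (fun t : R => t^-1 *: (F (t *: x + p) - F p)) @ 0^' --> slope p x.
  apply/cvgrPdist_le => e e0.
  set K := hi / 2 * dot x x.
  have K0 : 0 <= K by rewrite mulr_ge0 ?dot_ge0// divr_ge0.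
  near=> t.
  have t0 : t != 0 by near: t; exact: nbhs_dnbhs_neq.
  have te : `|t| <= e / (K + 1).
    near: t; apply: dnbhs0_le; by rewrite divr_gt0// ltr_wpDl.
  have := slope_normP p x t; rewrite -/K [p + _]addrC => hs.
  rewrite distrC [_ *: _]mulrC.
  have -> : (F (t *: x + p) - F p) / t - slope p x = ((F (t *: x + p) - F p) - t * slope p x) / t.
    by field.
  rewrite normrM normfV ler_pdivrMr ?normr_gt0// (le_trans hs)//.
  rewrite -real_normK ?num_real// expr2 mulrA ler_pM2r ?normr_gt0//.
  apply: le_trans (ler_wpM2l K0 te) _.
  by rewrite mulrCA ler_piMr ?(ltW e0)// ler_pdivrMr ?ltr_wpDl// mul1r lerDl.
by apply: DeriveDef; [apply/cvg_ex; exists (slope p x)|exact/cvg_lim].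
Unshelve. all: by end_near. Qed.

Lemma slopeE p x : slope p x = dot (grad F p) x.
Proof.
have gE i : grad F p 0 i = slope p (delta_mx 0 i).
  by rewrite mxE /partial; have := slope_derive p (delta_mx 0 i) => /@derive_val.
rewrite [in LHS](row_sum_delta x) (big_morph (slope p) (slopeD p) (slope0 p)).
by apply: eq_bigr => i _; rewrite slopeZ gE mulrC.
Qed.

(** Every later use of convexity goes through this form of the hypothesis: below,
    it gives paraboloids touching [F] from below; on both sides, it makes the
    Bregman distance comparable with the squared Euclidean one. *)
Lemma quad_convex_expansion p q :
  lo / 2 * dot (q - p) (q - p) <= F q - F p - dot (grad F p) (q - p)
  <= hi / 2 * dot (q - p) (q - p).
Proof.
have := slopeP p (q - p) 1.
have -> : p + 1 *: (q - p) = q by rewrite scale1r addrC subrK.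
by rewrite expr1n !mul1r slopeE.
Qed.

(** Compare the values at [p], where the tilted function
    [z |-> F z - dot (grad F p) z] is minimal, and at the gradient descent
    step from [q]. *)
Lemma grad_lipschitz p q : 0 < hi ->
  dot (grad F q - grad F p) (grad F q - grad F p) <= hi ^+ 2 * dot (q - p) (q - p).
Proof.
move=> h0; set w := grad F q - grad F p.
pose z := q - hi^-1 *: w.
have /andP[_ h1] := quad_convex_expansion p q.
have /andP[h2 _] := quad_convex_expansion p z.
have /andP[_ h3] := quad_convex_expansion q z.
have l0 : 0 <= lo / 2 * dot (z - p) (z - p) by rewrite mulr_ge0 ?dot_ge0// divr_ge0.
have wE : dot (grad F q) w - dot (grad F p) w = dot w w by rewrite -dotBl.
have zq : z - q = - (hi^-1 *: w) by rewrite /z addrAC subrr add0r.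
have zp : z - p = (q - p) - hi^-1 *: w by rewrite /z addrAC.
rewrite zp in h2 l0; clearbody w.
rewrite zq ?(dotNl, dotNr, dotZl, dotZr) ?mulrN ?opprK in h3.
rewrite [dot (grad F p) _]dotBr dotZr in h2.
have hne : hi != 0 by rewrite lt0r_neq0.
have E : hi / 2 * (hi^-1 * (hi^-1 * dot w w)) = hi^-1 * (dot w w / 2) by field.
move: h1 h2 h3 l0 wE; rewrite E.
move: (F q) (F p) (F z) (dot (grad F p) (q - p)) (dot (grad F p) w) (dot (grad F q) w) (dot w w) (lo / 2 * _) (dot (q - p) (q - p)) => a b c u v v' W l N.
move=> h1 h2 h3 l0 wE.
have : hi^-1 * (W / 2) <= hi / 2 * N.
  have e1 : hi^-1 * v' - hi^-1 * v = hi^-1 * W by rewrite -mulrBr wE.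
  by lra.
rewrite mulrC ler_pdivrMr//; lra.
Qed.

Lemma quad_convex_continuous : continuous F.
Proof.
move=> p.
have idc i : (fun q : 'rV[R]_n => q 0 i) @ p --> p 0 i by exact: coord_continuous.
have qpc i : (fun q : 'rV[R]_n => (q - p) 0 i) @ p --> (0 : 'rV[R]_n) 0 i.
  have E : (fun q : 'rV[R]_n => (q - p) 0 i) = (fun q : 'rV[R]_n => q 0 i) - cst (p 0 i).
    by apply/funext => q; rewrite !mxE.
  rewrite E mxE -(subrr (p 0 i)). exact: (cvgB (idc i) (cvg_cst (p 0 i))).
have c1 : (fun q : 'rV[R]_n => dot (grad F p) (q - p)) @ p --> dot (grad F p) 0.
  apply: (@cvg_dot R n 'rV[R]_n (nbhs p) _ (fun=> grad F p) (fun q => q - p)) => //.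
  by move=> i; exact: cvg_cst.
have c2 : (fun q : 'rV[R]_n => dot (q - p) (q - p)) @ p --> dot (0 : 'rV[R]_n) 0.
  exact: (@cvg_dot R n 'rV[R]_n (nbhs p) _ (fun q => q - p) (fun q => q - p)).
rewrite dot0r in c1; rewrite dot0r in c2.
have sq k := @cvg_affine_pair R 'rV[R]_n (nbhs p) _ _ _ (F p) k c1 c2.
have hsq : \forall q \near p, F p + dot (grad F p) (q - p) + lo / 2 * dot (q - p) (q - p) <= F q <= F p + dot (grad F p) (q - p) + hi / 2 * dot (q - p) (q - p).
  apply: (@nearW _ (nbhs p)) => q; have /andP[h1 h2] := quad_convex_expansion p q.
  by apply/andP; split; lra.
exact: (@squeeze_cvgr _ (nbhs p) _ _ _ _ F hsq _ (sq _ _) (sq _ _)).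
Qed.

End quad_convex_gradient.

(** * Differentiation along lines and symmetry of second derivatives *)

Lemma nbhs_norm (R : realType) (n : nat) (x : 'rV[R]_n) (P : set 'rV[R]_n) :
  nbhs x P -> exists2 r, 0 < r & forall y, `|y - x| < r -> P y.
Proof.
move=> /nbhs_ballP[r /= r0 hr]; exists r => // y yr.
by apply: hr; rewrite -ball_normE /= distrC.
Qed.

Lemma third_distance (R : realFieldType) (a b p : R) :
  `|a - p| < `|a - b| / 3 -> `|b - p| < `|a - b| / 3 -> False.
Proof.
move=> h1 h2.
have : `|a - b| <= `|a - p| + `|b - p|.
  by rewrite (_ : a - b = (a - p) - (b - p)) ?ler_normB//; ring.
have := normr_ge0 (a - p); lra.
Qed.

Section lines.
Variables (R : realType) (n : nat).
Implicit Types (f g : 'rV[R]_n -> R) (x y u v : 'rV[R]_n).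

Lemma is_derive_line f x u (t l : R) :
  is_derive (x + t *: u) u f l <-> is_derive t 1 (fun s => f (x + s *: u)) l.
Proof.
have E : (fun h : R => h^-1 *: ((f \o shift (x + t *: u)) (h *: u) - f (x + t *: u))) =
  (fun h : R => h^-1 *: (((fun s => f (x + s *: u)) \o shift t) (h *: (1 : R)) - f (x + t *: u))).
  apply/funext => h /=; congr (_ *: (f _ - _)).
  by rewrite scalerDl addrCA [h *: 1]mulr1.
by split=> -[h1 h2]; apply: DeriveDef; move: h1 h2; rewrite /derivable /derive E.
Qed.

Lemma is_deriveZdir f x v (c l : R) :
  is_derive x v f l -> is_derive x (c *: v) f (c * l).
Proof.
have z w : x = x + (0 : R) *: w by rewrite scale0r addr0.
rewrite {1}(z v) => /is_derive_line h; rewrite (z (c *: v)); apply/is_derive_line.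
have hc : is_derive (0 : R) (1 : R) (fun s : R => s * c) c.
  have := is_deriveM (is_derive_id (0 : R) (1 : R)) (is_derive_cst c (0 : R) (1 : R)).
  by move=> h'; apply: is_derive_eq h' _; rewrite scaler0 add0r /GRing.scale /= mulr1.
have h' : is_derive ((0 : R) * c) 1 (fun s => f (x + s *: v)) l by rewrite mul0r.
have := @is_derive1_comp R (fun s => f (x + s *: v)) (fun s : R => s * c) 0 l c h' hc.
rewrite mulrC.
rewrite (_ : _ \o _ = fun s => f (x + s *: (c *: v)))//.
by apply/funext => s /=; rewrite scalerA.
Qed.

Lemma line_MVT f (f1 : 'rV[R]_n -> R) x u (h : R) : 0 <= h ->
  (forall t, 0 <= t <= h -> is_derive (x + t *: u) u f (f1 (x + t *: u))) ->
  exists2 t, 0 <= t <= h & f (x + h *: u) - f x = h * f1 (x + t *: u).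
Proof.
move=> h0 hf.
have hd t : 0 <= t <= h -> is_derive t 1 (fun s => f (x + s *: u)) (f1 (x + t *: u)).
  by move=> /hf /is_derive_line.
have [||t tI E] := @MVT_segment R (fun s => f (x + s *: u)) (fun s => f1 (x + s *: u)) 0 h h0.
- by move=> t; rewrite in_itv/= => /andP[t0 t1]; apply: hd; rewrite !ltW.
- apply: derivable_within_continuous => t; rewrite in_itv/= => tI.
  by have [] := hd t tI.
- exists t; first by rewrite in_itv/= in tI.
  by move: E; rewrite scale0r addr0 subr0 mulrC.
Qed.

(** The mean value theorem in the direction [u], then in the direction [v]. *)
Lemma second_difference f (f1 f2 : 'rV[R]_n -> R) x u v (h : R) : 0 <= h ->
  (forall a b, 0 <= a <= h -> 0 <= b <= h ->
    is_derive (x + a *: u + b *: v) u f (f1 (x + a *: u + b *: v)) /\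
    is_derive (x + a *: u + b *: v) v f1 (f2 (x + a *: u + b *: v))) ->
  exists a b, [/\ 0 <= a <= h, 0 <= b <= h &
    f (x + h *: u + h *: v) - f (x + h *: u) - f (x + h *: v) + f x =
    h ^+ 2 * f2 (x + a *: u + b *: v)].
Proof.
move=> h0 H.
have hh : 0 <= h <= h by rewrite h0 lexx.
have h00 : 0 <= (0 : R) <= h by rewrite h0 lexx.
have [|a aI E] := @line_MVT (fun y => f (y + h *: v) - f y)
  (fun y => f1 (y + h *: v) - f1 y) x u h h0.
  move=> t tI; apply: is_deriveB; last first.
    by have [+ _] := H t 0 tI h00; rewrite scale0r addr0.
  apply/is_derive_line; have [+ _] := H t h tI hh.
  rewrite addrAC => /is_derive_line.
  by rewrite (_ : (fun s => _) = (fun s => f (x + s *: u + h *: v)))//; apply/funext => s; rewrite addrAC.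
have [b bI E'] := @line_MVT f1 f2 (x + a *: u) v h h0 (fun t tI => (H a t aI tI).2).
exists a, b; split=> //; move: E; rewrite E' mulrA -expr2 => <-; ring.
Qed.

(** The second difference of [f] is symmetric in its two directions, so the two mixed
    derivatives coincide at two nearby points; conclude by continuity. *)
Lemma schwarz f (U : set 'rV[R]_n) x (i j : 'I_n) : open U -> Ck_on 2 U f -> U x ->
  partial j (partial i f) x = partial i (partial j f) x.
Proof.
move=> oU [_ hf] Ux.
have cij k l y : U y -> {for y, continuous (partial l (partial k f))}.
  by move=> Uy; have [_ [_ /(_ l)[_ [+ _]]]] := hf k; apply.
have d1 k y : U y -> is_derive y (delta_mx 0 k) f (partial k f y).
  by move=> Uy; apply: derivableP; have [+ _] := hf k; apply.
have d2 k l y : U y -> is_derive y (delta_mx 0 l) (partial k f) (partial l (partial k f) y).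
  by move=> Uy; apply: derivableP; have [_ [_ /(_ l)[+ _]]] := hf k; apply.
apply/eqP; rewrite -subr_eq0 -normr_le0 leNgt; apply/negP.
set A := partial j (partial i f) x; set B := partial i (partial j f) x => AB.
pose e := `|A - B| / 3; have e0 : 0 < e by rewrite divr_gt0.
have /cvgrPdist_lt/(_ e e0) c1 := cij i j x Ux.
have /cvgrPdist_lt/(_ e e0) c2 := cij j i x Ux.
have c3 : nbhs x U by exact: open_nbhs_nbhs.
have [r r0 hr] := nbhs_norm (@filterI _ (nbhs x) _ _ _ c3 (@filterI _ (nbhs x) _ _ _ c1 c2)).
have h0 : 0 < r / 3 by rewrite divr_gt0.
set h := r / 3 in h0.
have inball a b k l : 0 <= a <= h -> 0 <= b <= h ->
   `|x + a *: delta_mx 0 k + b *: delta_mx 0 l - x| < r.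
  move=> /andP[a0 ah] /andP[b0 bh]; have -> : x + a *: delta_mx 0 k + b *: delta_mx 0 l - x =
     a *: delta_mx 0 k + b *: delta_mx 0 l by rewrite addrAC [x + _]addrC addrK.
  rewrite (le_lt_trans (ler_normD _ _))// !normrZ (ger0_norm a0) (ger0_norm b0).
  have dle m : `|delta_mx 0 m : 'rV[R]_n| <= 1.
    apply: rV_norm_le => // q; rewrite mxE eqxx /=; case: eqP => _; by rewrite ?normr1 ?normr0.
  have := dle k; have := dle l.
  move: (normr_ge0 (delta_mx 0 k : 'rV[R]_n)) (normr_ge0 (delta_mx 0 l : 'rV[R]_n)).
  set p := `|_|; set q := `|_| => p0 q0 q1 p1.
  have ap : a * p <= h by rewrite (le_trans _ ah)// ler_piMr.
  have bq : b * q <= h by rewrite (le_trans _ bh)// ler_piMr.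
  rewrite /h in ap bq; lra.
have [a [b [aI bI E1]]] := @second_difference f (partial i f) (partial j (partial i f))
  x (delta_mx 0 i) (delta_mx 0 j) h (ltW h0) (fun a b aI bI =>
   let U' := (hr _ (inball a b i j aI bI)).1 in
   conj (d1 i _ U') (d2 i j _ U')).
have [c [d [cI dI E2]]] := @second_difference f (partial j f) (partial i (partial j f))
  x (delta_mx 0 j) (delta_mx 0 i) h (ltW h0) (fun a b aI bI =>
   let U' := (hr _ (inball a b j i aI bI)).1 in
   conj (d1 j _ U') (d2 j i _ U')).
have [_ [e1 _]] := hr _ (inball a b i j aI bI).
have [_ [_ e2]] := hr _ (inball c d j i cI dI).
have E : partial j (partial i f) (x + a *: delta_mx 0 i + b *: delta_mx 0 j) =
         partial i (partial j f) (x + c *: delta_mx 0 j + d *: delta_mx 0 i).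
  have hn : h ^+ 2 != 0 by rewrite expf_neq0// gt_eqF.
  have S (u v w z : R) : u - v - w + z = u - w - v + z by rewrite [u - v - w]addrAC.
  rewrite [x + h *: delta_mx 0 i + _]addrAC S in E1.
  have E12 := etrans (esym E1) E2.
  exact: (mulfI hn E12).
rewrite E in e1; exact: (third_distance e1 e2).
Qed.

End lines.

(** * Second order jets along lines *)

Section C1_differentiability.
Variables (R : realType) (n : nat) (U : set 'rV[R]_n) (f : 'rV[R]_n -> R).
Hypotheses (oU : open U) (hf : Ck_on 1 U f).
Implicit Types (x y : 'rV[R]_n).

Let d1 k y : U y -> is_derive y (delta_mx 0 k) f (partial k f y).
Proof. by move=> Uy; apply: derivableP; have [_ /(_ k)[+ _]] := hf; apply. Qed.

Let c1 k y : U y -> {for y, continuous (partial k f)}.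
Proof. by move=> Uy; have [_ /(_ k)[_ [+ _]]] := hf; apply. Qed.

Lemma partials_near x (e : R) : U x -> 0 < e -> exists2 r, 0 < r &
  forall y, `|y - x| < r -> U y /\ forall k, `|partial k f y - partial k f x| < e.
Proof.
move=> Ux e0.
have nP k : nbhs x (fun y => `|partial k f x - partial k f y| < e).
  by have /cvgrPdist_lt/(_ e e0) := @c1 k x Ux.
have nU : nbhs x U by exact: open_nbhs_nbhs.
have [rU rU0 hU] := nbhs_norm nU.
have hr k : {r : R | 0 < r /\ forall y, `|y - x| < r -> `|partial k f x - partial k f y| < e}.
  by apply: cid; have [r r0 h] := nbhs_norm (nP k); exists r.
pose r := \big[Order.min/rU]_k sval (hr k).
have r0 : 0 < r by apply/bigmin_gtP; split => // k _; exact: (svalP (hr k)).1.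
exists r => // y yr; split; first by apply: hU; exact: (lt_le_trans yr (bigmin_le_id _ _ _ _)).
move=> k; rewrite distrC; apply: (svalP (hr k)).2.
by apply: (lt_le_trans yr); apply: bigmin_le_cond.
Qed.

(** Move from [x] to [x + y] one coordinate at a time and use the mean value
    theorem on each leg. *)
Lemma C1_expansion x (e : R) : U x -> 0 < e -> exists2 r, 0 < r &
  forall y, `|y| < r -> `|f (x + y) - f x - dot (grad f x) y| <= e * \sum_i `|y 0 i|.
Proof.
move=> Ux e0; have [r r0 hr] := partials_near Ux e0.
exists r => // y yr.
pose tr (k : nat) : 'rV[R]_n := \row_i (if (i < k)%N then y 0 i else 0).
have tr0 : tr 0%N = 0 by apply/rowP => i; rewrite !mxE ltn0.
have trn : tr n = y by apply/rowP => i; rewrite !mxE ltn_ord.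
have trS (k : 'I_n) : tr k.+1 = tr k + y 0 k *: delta_mx 0 k.
  apply/rowP => i; rewrite !mxE eqxx /= ltnS leq_eqVlt -val_eqE /=.
  case: (ltngtP i k) => [ik|ik|/val_inj ->] /=; rewrite ?mulr0 ?addr0 ?mulr1 ?add0r//.
have -> : f (x + y) - f x = \sum_(k < n) (f (x + tr k.+1) - f (x + tr k)).
  rewrite -(big_mkord xpredT (fun k => f (x + tr k.+1) - f (x + tr k))).
  by rewrite telescope_sumr// trn tr0 addr0.
rewrite /dot -sumrB mulr_sumr.
apply: le_trans (ler_norm_sum _ _ _) _; apply: ler_sum => k _.
have hin t : 0 <= t <= 1 -> `|x + tr k + t *: (y 0 k *: delta_mx 0 k) - x| < r.
  move=> /andP[t0 t1].
  have -> : x + tr k + t *: (y 0 k *: delta_mx 0 k) - x = tr k + t *: (y 0 k *: delta_mx 0 k).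
    by rewrite addrAC [x + _]addrC addrK.
  apply: rV_norm_lt => // i; apply: le_lt_trans yr; apply: le_trans (rV_entry_le y i).
  rewrite !mxE eqxx /=; case: (ltngtP i k) => [ik|ik|/val_inj ->] /=.
  - by rewrite -val_eqE /= ltn_eqF// !mulr0 addr0.
  - by rewrite -val_eqE /= gtn_eqF// !mulr0 addr0 normr0.
  - by rewrite eqxx mulr1 add0r normrM (ger0_norm t0) ler_piMl.
rewrite trS addrA mxE -[y 0 k *: _]scale1r.
have [|t tI ->] := @line_MVT _ _ f (fun z => y 0 k * partial k f z) (x + tr k)
  (y 0 k *: delta_mx 0 k) 1 ler01.
  by move=> t tI; apply: is_deriveZdir; apply: d1; exact: (hr _ (hin t tI)).1.
have /ltW h := (hr _ (hin t tI)).2 k.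
rewrite mul1r [_ * y 0 k]mulrC -mulrBr normrM mulrC.
by apply: ler_wpM2r.
Qed.

Lemma C1_is_derive x v : U x -> is_derive x v f (dot (grad f x) v).
Proof.
move=> Ux; set l := dot _ _; set S := \sum_i `|v 0 i|.
have S0 : 0 <= S by apply: sumr_ge0.
have h : (fun t : R => t^-1 *: (f (t *: v + x) - f x)) @ 0^' --> l.
  apply/cvgrPdist_le => e e0.
  have e1 : 0 < e / (S + 1) by rewrite divr_gt0// ltr_wpDl.
  have [r r0 hr] := C1_expansion Ux e1.
  near=> t.
  have t0 : t != 0 by near: t; exact: nbhs_dnbhs_neq.
  have tr : `|t| < r / (`|v| + 1).
    by near: t; apply: dnbhs0_lt; rewrite divr_gt0// ltr_wpDl.
  have tv : `|t *: v| < r.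
    rewrite normrZ; apply: le_lt_trans (_ : `|t| * (`|v| + 1) < r).
      by rewrite ler_wpM2l// lerDl.
    by rewrite -ltr_pdivlMr// ltr_wpDl.
  have := hr _ tv; rewrite dotZr -/l [x + _]addrC => hs.
  rewrite distrC [_ *: _]mulrC.
  have -> : (f (t *: v + x) - f x) / t - l = (f (t *: v + x) - f x - t * l) / t by field.
  rewrite normrM normfV ler_pdivrMr ?normr_gt0// (le_trans hs)//.
  have -> : \sum_i `|(t *: v) 0 i| = `|t| * S.
    by rewrite mulr_sumr; apply: eq_bigr => i _; rewrite mxE normrM.
  rewrite mulrCA mulrC ler_pM2r ?normr_gt0// mulrAC ler_pdivrMr ?ltr_wpDl//.
  by rewrite ler_pM2l// lerDl.
by apply: DeriveDef; [apply/cvg_ex; exists l|exact/cvg_lim].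
Unshelve. all: by end_near. Qed.

End C1_differentiability.

(** A relation, so that the value and the first two derivatives at [0] of a long
    expression are computed by composing closure rules. The derivative [phi1] is
    asked to exist near [0] only, since functions are smooth only in an open set. *)
Definition jet2 (R : realType) (phi : R -> R) (a b c : R) : Prop :=
  exists phi1 : R -> R,
    [/\ \forall t \near (0 : R), is_derive t (1 : R) phi (phi1 t),
        phi 0 = a, phi1 0 = b & is_derive (0 : R) (1 : R) phi1 c].

Section jets.
Variable R : realType.
Implicit Types phi psi : R -> R.

Lemma jet2_eq phi psi a b c a' b' c' : jet2 phi a b c ->
  phi =1 psi -> a = a' -> b = b' -> c = c' -> jet2 psi a' b' c'.
Proof. by move=> h /funext <- <- <- <-. Qed.

Lemma jet2_cst (k : R) : jet2 (fun=> k) k 0 0.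
Proof.
exists (fun=> 0); split=> //; last exact: is_derive_cst.
by near=> t; exact: is_derive_cst.
Unshelve. all: by end_near. Qed.

Lemma jet2_id : jet2 (fun t : R => t) 0 1 0.
Proof.
exists (fun=> 1); split=> //; last exact: is_derive_cst.
by near=> t; exact: is_derive_id.
Unshelve. all: by end_near. Qed.

Lemma jet2D phi psi a b c a' b' c' : jet2 phi a b c -> jet2 psi a' b' c' ->
  jet2 (fun t => phi t + psi t) (a + a') (b + b') (c + c').
Proof.
move=> [f1 [nf f0 f10 d]] [g1 [ng g0 g10 d']].
exists (fun t => f1 t + g1 t); split; rewrite ?f0 ?g0 ?f10 ?g10//.
- by near=> t; apply: is_deriveD; [near: t; exact: nf|near: t; exact: ng].
- exact: is_deriveD.
Unshelve. all: by end_near. Qed.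

Lemma jet2M phi psi a b c a' b' c' : jet2 phi a b c -> jet2 psi a' b' c' ->
  jet2 (fun t => phi t * psi t) (a * a') (a * b' + b * a')
    (a * c' + 2 * b * b' + c * a').
Proof.
move=> [f1 [nf f0 f10 d]] [g1 [ng g0 g10 d']].
exists (fun t => phi t * g1 t + psi t * f1 t); split; rewrite ?f0 ?g0 ?f10 ?g10//.
- by near=> t; apply: is_deriveM; [near: t; exact: nf|near: t; exact: ng].
- by congr (_ + _); rewrite mulrC.
- have df : is_derive (0 : R) (1 : R) phi (f1 0) by exact: (nbhs_singleton nf).
  have dg : is_derive (0 : R) (1 : R) psi (g1 0) by exact: (nbhs_singleton ng).
  apply: is_derive_eq (is_deriveD (is_deriveM df d') (is_deriveM dg d)) _.
  by rewrite /GRing.scale /= f0 g0 f10 g10; ring.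
Unshelve. all: by end_near. Qed.

Lemma jet2N phi a b c : jet2 phi a b c -> jet2 (fun t => - phi t) (- a) (- b) (- c).
Proof.
move=> h; apply: (jet2_eq (jet2M (jet2_cst (-1)) h)) => [t|||]; rewrite ?mulN1r//; ring.
Qed.

Lemma jet2Z (k : R) phi a b c : jet2 phi a b c ->
  jet2 (fun t => k * phi t) (k * a) (k * b) (k * c).
Proof.
move=> h; apply: (jet2_eq (jet2M (jet2_cst k) h)) => //; ring.
Qed.

Lemma jet2_sum n (phi : 'I_n -> R -> R) (a b c : 'I_n -> R) :
  (forall i, jet2 (phi i) (a i) (b i) (c i)) ->
  jet2 (fun t => \sum_i phi i t) (\sum_i a i) (\sum_i b i) (\sum_i c i).
Proof.
move=> h; elim: (index_enum _) => [|i s IH].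
  apply: (jet2_eq (jet2_cst 0)) => [t|||]; by rewrite big_nil.
apply: (jet2_eq (jet2D (h i) IH)) => [t|||]; by rewrite big_cons.
Qed.

Lemma jet2_exp phi a b c : jet2 phi a b c ->
  jet2 (fun t => expR (phi t)) (expR a) (expR a * b) (expR a * (b ^+ 2 + c)).
Proof.
move=> [f1 [nf f0 f10 d]].
have de t : is_derive t (1 : R) phi (f1 t) -> is_derive t (1 : R) (fun t => expR (phi t)) (expR (phi t) * f1 t).
  by move=> h; exact: (@is_derive1_comp R expR phi t _ _ (is_derive_expR _) h).
exists (fun t => expR (phi t) * f1 t); split; rewrite ?f0 ?f10//.
- by near=> t; apply: de; near: t; exact: nf.
- have h0 := de 0 (nbhs_singleton nf).
  apply: is_derive_eq (is_deriveM h0 d) _.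
  by rewrite /GRing.scale /= f0 f10; ring.
Unshelve. all: by end_near. Qed.

(** If [c] were positive, the derivative would be positive just to the right of
    [0], and the mean value theorem would contradict maximality. *)
Lemma jet2_max phi a b c : jet2 phi a b c ->
  (\forall t \near (0 : R), phi t <= phi 0) -> b = 0 /\ c <= 0.
Proof.
move=> [f1 [nf f0 <- d]] nmax.
have /nbhs_ballP[r /= r0 hr] : \forall t \near (0 : R), is_derive t (1 : R) phi (f1 t) /\ phi t <= phi 0.
  by near=> t; split; near: t.
have hr' t : `|t| < r -> is_derive t (1 : R) phi (f1 t) /\ phi t <= phi 0.
  by move=> tr; apply: hr; rewrite -ball_normE /= sub0r normrN.
have b0 : f1 0 = 0.
  have n0 : `|0 : R| < r by rewrite normr0.
  have [_ <-] := (hr' 0 n0).1.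
  suff [_ ->] : is_derive (0 : R) (1 : R) phi 0 by [].
  apply: (@derive1_at_max R phi (- r) r 0).
  - by lra.
  - by move=> t; rewrite in_itv/= => /andP[t1 t2]; have [] := (hr' t _).1; rewrite // ltr_norml t1.
  - by rewrite in_itv/= oppr_lt0 r0.
  - by move=> t; rewrite in_itv/= => /andP[t1 t2]; apply: (hr' t _).2; rewrite ltr_norml t1.
split=> //; rewrite leNgt; apply/negP => c0.
have [s s0 hs] : exists2 s, 0 < s & forall t, 0 < t < s -> 0 < f1 t.
  have [dv dE] := d.
  have : (fun h : R => h^-1 *: ((f1 \o shift 0) (h *: (1:R)) - f1 0)) @ 0^' --> c.
    by rewrite -dE; exact: dv.
  move=> /cvgrPdist_lt/(_ c c0).
  rewrite near_withinE => /nbhs_ballP[s /= s0 h]; exists s => // t /andP[t0 ts].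
  have := h t _ _; rewrite -ball_normE /= sub0r normrN gtr0_norm// => /(_ ts).
  rewrite gt_eqF// => /(_ isT); rewrite b0 subr0 addr0 [t *: 1]mulr1 [_ *: _]mulrC => ht.
  have : 0 < f1 t / t by move: ht; rewrite ltr_norml => /andP[_]; lra.
  by rewrite pmulr_lgt0// invr_gt0.
pose t := Num.min r s / 2.
have m0 : 0 < Num.min r s by rewrite lt_min r0.
have t0 : 0 < t by rewrite divr_gt0.
have tm : t < Num.min r s by rewrite /t; lra.
have [tr ts] : t < r /\ t < s by move: tm; rewrite lt_min => /andP[].
have [||z] := @MVT R phi f1 0 t t0.
- move=> z; rewrite in_itv/= => /andP[z0 zt]; apply: (hr' z _).1.
  by rewrite gtr0_norm// (lt_trans zt).
- apply: derivable_within_continuous => z; rewrite in_itv/= => /andP[z0 zt].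
  by have [] := (hr' z _).1; rewrite // ger0_norm// (le_lt_trans zt).
- rewrite in_itv/= => /andP[z0 zt].
  have f1z : 0 < f1 z by apply: hs; rewrite z0 (lt_trans zt).
  have := (hr' t _).2; rewrite gtr0_norm// => /(_ tr) phit E.
  have : 0 < f1 z * (t - 0) by rewrite mulr_gt0// subr_gt0.
  by rewrite -E subr_gt0 ltNge phit.
Unshelve. all: by end_near. Qed.

End jets.

Lemma Ck_on_partial (R : realType) (n k : nat) (U : set 'rV[R]_n) f i :
  Ck_on k.+1 U f -> Ck_on k U (partial i f).
Proof. by move=> [_ /(_ i)[]]. Qed.

Lemma Ck_on_pred (R : realType) (n k : nat) (U : set 'rV[R]_n) f :
  Ck_on k.+1 U f -> Ck_on k U f.
Proof.
elim: k f => [|k IH] f [cf hf]; first by split.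
by split=> // i; have [h1 h2] := hf i; split => //; exact: IH.
Qed.

Lemma line_near (R : realType) (n : nat) (U : set 'rV[R]_n) (x v : 'rV[R]_n) :
  nbhs x U -> \forall t \near (0 : R), U (x + t *: v).
Proof.
move=> nU; have [r r0 hr] := nbhs_norm nU.
have v0 : 0 < `|v| + 1 by rewrite ltr_wpDl.
apply/nbhs_ballP; exists (r / (`|v| + 1)) => /=; first by rewrite divr_gt0.
move=> t; rewrite -ball_normE /= sub0r normrN => tr.
apply: hr; rewrite addrC addKr normrZ.
apply: le_lt_trans (_ : `|t| * (`|v| + 1) < r).
  by rewrite ler_wpM2l// lerDl.
by rewrite -ltr_pdivlMr.
Qed.

Definition hess_form (R : realType) (n : nat) (f : 'rV[R]_n -> R) x (v : 'rV[R]_n) : R :=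
  \sum_i v 0 i * dot (grad (partial i f) x) v.

Lemma jet2_line (R : realType) (n : nat) (U : set 'rV[R]_n) f x v :
  open U -> Ck_on 2 U f -> U x ->
  jet2 (fun t => f (x + t *: v)) (f x) (dot (grad f x) v) (hess_form f x v).
Proof.
move=> oU hf Ux.
have x0 : x = x + (0 : R) *: v by rewrite scale0r addr0.
exists (fun t => dot (grad f (x + t *: v)) v); split; rewrite -?x0//.
- have nU := line_near v (@open_nbhs_nbhs _ x U (conj oU Ux)).
  near=> t; apply/is_derive_line; apply: (C1_is_derive oU (Ck_on_pred hf)).
  by near: t.
- rewrite (_ : (fun t => _) = \sum_i (fun t : R => v 0 i * partial i f (x + t *: v))); last first.
    by apply/funext => t; rewrite fct_sumE; apply: eq_bigr => i _; rewrite mxE mulrC.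
  apply: is_derive_sum => i; apply: is_deriveZ.
  apply/is_derive_line; rewrite -x0.
  exact: (C1_is_derive oU (Ck_on_partial i hf)).
Unshelve. all: by end_near. Qed.

(** * The scalar inequality at an interior maximum *)

(** With [X = |p - e|^2], [p] the gradient at the maximum point: the error terms add
    up to at most [quartic_const * X^2 + quadratic_const * X] plus a term in the
    weight. The weight [A] of the squared deviation [(v - e . x)^2] makes its
    contribution at least [(quartic_const * (1 + hi/4) + 3) X^2 / sigma], and
    [threshold_const] is such that each of the two remaining errors is at most
    [X^2 / sigma] once [z^2 X >= threshold_const * sigma]; its last summand makes [X]
    large enough for the lower bound on [P . (p - e)]. The [barrier_const]
    bounds 16 times the Bregman distance where [F (grad v)] is small. The letter
    [m] stands for the dimension. *)
Section constants.
Variables (R : realFieldType) (lo hi m : R).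

Definition quartic_const : R := 640 * hi ^+ 4 / lo + 16 * hi ^+ 3.
Definition quadratic_const : R :=
  512 * hi ^+ 4 / lo + 256 * hi ^+ 2 / lo + 16 * hi ^+ 3 + 8 * hi * m.
Definition weight_const : R := 8 / lo ^+ 2 * (quartic_const * (1 + hi / 4) + 3).
Definition threshold_const : R :=
  16 * quadratic_const + 32 * hi ^+ 2 * weight_const ^+ 2 / lo + 128 / lo.
Definition barrier_const : R := 16 * hi * (hi / lo + 1).

Hypotheses (lo0 : 0 < lo) (hi0 : 0 < hi) (m0 : 0 <= m).

Let hi2_ge0 : 0 <= hi ^+ 2. Proof. by rewrite exprn_ge0// ltW. Qed.
Let hi3_ge0 : 0 <= hi ^+ 3. Proof. by rewrite exprn_ge0// ltW. Qed.
Let hi4_ge0 : 0 <= hi ^+ 4. Proof. by rewrite exprn_ge0// ltW. Qed.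
Let div_lo_ge0 x : 0 <= x -> 0 <= x / lo.
Proof. by move=> x0; apply: divr_ge0 => //; exact: ltW. Qed.

Lemma quartic_const_ge0 : 0 <= quartic_const.
Proof. rewrite /quartic_const; have := div_lo_ge0 hi4_ge0; have := hi3_ge0; lra. Qed.

Lemma quadratic_const_ge0 : 0 <= quadratic_const.
Proof.
have := div_lo_ge0 hi4_ge0; have := div_lo_ge0 hi2_ge0; have := hi3_ge0.
have : 0 <= hi * m by rewrite mulr_ge0// ltW.
rewrite /quadratic_const; lra.
Qed.

Lemma weight_const_gt0 : 0 < weight_const.
Proof.
have h : 0 <= quartic_const * (1 + hi / 4).
  by apply: mulr_ge0; [exact: quartic_const_ge0|have := hi0; lra].
apply: mulr_gt0; first by apply: divr_gt0 => //; exact: exprn_gt0.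
lra.
Qed.

Let hiA_ge0 : 0 <= hi ^+ 2 * weight_const ^+ 2 / lo.
Proof. by apply: div_lo_ge0; apply: mulr_ge0 => //; exact: sqr_ge0. Qed.

Lemma hiA_term_ge0 : 0 <= 32 * hi ^+ 2 * weight_const ^+ 2 / lo.
Proof. by have := hiA_ge0; lra. Qed.

Lemma threshold_const_gt0 : 0 < threshold_const.
Proof.
have := hiA_ge0; have := quadratic_const_ge0; have : 0 < lo^-1 by rewrite invr_gt0.
rewrite /threshold_const; move: (quadratic_const) => q; lra.
Qed.

Lemma barrier_const_gt0 : 0 < barrier_const.
Proof.
rewrite /barrier_const; apply: mulr_gt0; first exact: mulr_gt0.
have := div_lo_ge0 (ltW hi0); lra.
Qed.

(** The conclusion of the maximum principle in real numbers: [z] is the cutoff, [g] the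
    Bregman distance, [qP = (p - e) . P] with [P = grad F p], [P2] and [G2] the squared
    norms of [P] and [P - grad F e], [b2] that of [b = D^2 v . P], [cGb] the mixed term
    of the cutoff, [NT] the third derivatives and [r2 = |D^2 v . N|^2]. The good Hessian
    term [z^2 lo b2] absorbs the multiples of [b2] in the bounds of [NT] and [cGb];
    what is left is measured in the unit [Y = X^2 / sigma]. *)
Lemma interior_absurd (sigma z X g NT b2 cGb P2 G2 r2 qP : R) :
  0 < sigma -> sigma <= 1 + hi / 4 -> 0 < z -> z <= 4 -> 0 <= b2 ->
  threshold_const * sigma <= z ^+ 2 * X ->
  0 <= g -> g <= hi / 2 * X ->
  0 <= G2 -> G2 <= hi ^+ 2 * X ->
  0 <= P2 -> P2 <= hi ^+ 2 * (2 * X + 2) ->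
  lo / 4 * X <= qP ->
  r2 <= 128 * z ^+ 2 * g ^+ 2 + 8 * weight_const ^+ 2 * X ->
  - NT <= lo / 4 * z ^+ 2 * b2 + hi ^+ 2 * r2 / (lo / 4 * z ^+ 2) ->
  8 * z * cGb <= lo / 4 * z ^+ 2 * b2 + 256 / lo * (P2 * G2) ->
  NT + z ^+ 2 * lo * b2 - 8 * z * cGb - 256 / lo * G2 - 4 * z * g * (P2 + m)
    + 2 * (weight_const / sigma) * qP ^+ 2 <= 0 ->
  False.
Proof.
move=> s0 sS z0 z4 b20 hX g0 gX G0 GX P0 PX hqP hr hNT hGb hmain.
have K1 := quartic_const_ge0; have K2 := quadratic_const_ge0.
have A0 := weight_const_gt0; have C0 := threshold_const_gt0.
set C := threshold_const in hX C0; set A := weight_const in hr hmain A0.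
have z2 : 0 < z ^+ 2 by rewrite exprn_gt0.
have z16 : z ^+ 2 <= 16 by rewrite expr2; nra.
have X0 : 0 < X.
  by rewrite -(pmulr_rgt0 _ z2); apply: lt_le_trans hX; rewrite mulr_gt0.
(* The bound on sigma gives X^2 <= (1 + hi/4) Y; the lower bound on z^2 X gives
   C X <= z^2 Y <= 16 Y. *)
pose Y := X ^+ 2 / sigma.
have Y0 : 0 < Y by rewrite divr_gt0// exprn_gt0.
have XY : X ^+ 2 = sigma * Y by rewrite /Y mulrC divfK// gt_eqF.
have X2S : X ^+ 2 <= (1 + hi / 4) * Y by rewrite XY ler_wpM2r// ltW.
have YE k : k * Y = X * (k * X / sigma) by rewrite /Y; field; rewrite gt_eqF.
have XC : X * C <= 16 * Y.
  rewrite YE ler_pM2l// ler_pdivlMr//.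
  by apply: le_trans hX _; rewrite ler_wpM2r// ltW.
have XzY : X * C <= z ^+ 2 * Y by rewrite YE ler_pM2l// ler_pdivlMr.
have hr' : hi ^+ 2 * r2 / (lo / 4 * z ^+ 2) <=
    128 * hi ^+ 4 / lo * X ^+ 2 + 32 * hi ^+ 2 * A ^+ 2 / lo / C * Y.
  have loz : 0 < lo / 4 * z ^+ 2 by apply: mulr_gt0 => //; exact: divr_gt0.
  have hh : 0 < hi ^+ 2 by exact: exprn_gt0.
  have A2 : 0 < 8 * A ^+ 2 by apply: mulr_gt0 => //; exact: exprn_gt0.
  have z128 : 0 < 128 * z ^+ 2 by lra.
  rewrite ler_pdivrMr//.
  have -> : (128 * hi ^+ 4 / lo * X ^+ 2 + 32 * hi ^+ 2 * A ^+ 2 / lo / C * Y) * (lo / 4 * z ^+ 2)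
     = hi ^+ 2 * (32 * hi ^+ 2 * X ^+ 2 * z ^+ 2 + 8 * A ^+ 2 * (z ^+ 2 * Y / C)).
    by field; rewrite !gt_eqF.
  rewrite ler_pM2l//; apply: le_trans hr _; apply: lerD.
    have gg : g ^+ 2 <= (hi / 2 * X) ^+ 2 by rewrite ler_pXn2r// nnegrE (le_trans g0).
    have -> : 32 * hi ^+ 2 * X ^+ 2 * z ^+ 2 = 128 * z ^+ 2 * (hi / 2 * X) ^+ 2 by field.
    by rewrite ler_pM2l.
  by rewrite ler_pM2l// ler_pdivlMr.
have hqP2 : A * (lo ^+ 2 / 8) * Y <= 2 * (A / sigma) * qP ^+ 2.
  have -> : A * (lo ^+ 2 / 8) * Y = 2 * (A / sigma) * (lo / 4 * X) ^+ 2.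
    by rewrite /Y; field; rewrite gt_eqF.
  have As : 0 < 2 * (A / sigma) by apply: mulr_gt0 => //; exact: divr_gt0.
  have loX : 0 <= lo / 4 * X by have := mulr_gt0 lo0 X0; lra.
  by rewrite ler_pM2l// ler_pXn2r// nnegrE (le_trans loX).
have hA : A * (lo ^+ 2 / 8) = quartic_const * (1 + hi / 4) + 3.
  by rewrite /A /weight_const; field; rewrite gt_eqF.
move: hqP2; rewrite hA => hqP2.
have hPG : P2 * G2 <= 2 * hi ^+ 4 * X ^+ 2 + 2 * hi ^+ 4 * X.
  have -> : 2 * hi ^+ 4 * X ^+ 2 + 2 * hi ^+ 4 * X = hi ^+ 2 * (2 * X + 2) * (hi ^+ 2 * X) by ring.
  exact: ler_pM.
have hgP : 4 * z * g * (P2 + m) <= 16 * hi ^+ 3 * X ^+ 2 + (16 * hi ^+ 3 + 8 * hi * m) * X.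
  have -> : 16 * hi ^+ 3 * X ^+ 2 + (16 * hi ^+ 3 + 8 * hi * m) * X =
      16 * (hi / 2 * X) * (hi ^+ 2 * (2 * X + 2) + m) by field.
  have z40 : 0 <= 4 * z by lra.
  apply: ler_pM; [exact: mulr_ge0|exact: addr_ge0| |by rewrite lerD2r].
  by apply: ler_pM => //; lra.
have li : 0 < lo^-1 by rewrite invr_gt0.
have l256 : 0 < 256 / lo by lra.
have hPG' : 256 / lo * (P2 * G2) <= 512 * hi ^+ 4 / lo * X ^+ 2 + 512 * hi ^+ 4 / lo * X.
  have -> : 512 * hi ^+ 4 / lo * X ^+ 2 + 512 * hi ^+ 4 / lo * X = 256 / lo * (2 * hi ^+ 4 * X ^+ 2 + 2 * hi ^+ 4 * X).
    by field; rewrite gt_eqF.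
  by rewrite ler_pM2l.
have hG' : 256 / lo * G2 <= 256 * hi ^+ 2 / lo * X.
  have -> : 256 * hi ^+ 2 / lo * X = 256 / lo * (hi ^+ 2 * X) by field; rewrite gt_eqF.
  by rewrite ler_pM2l.
have e1 : quartic_const * X ^+ 2 <= quartic_const * (1 + hi / 4) * Y.
  by rewrite -mulrA ler_wpM2l.
have hA2 : 0 <= hi ^+ 2 * A ^+ 2 / lo by exact: hiA_ge0.
have CQ : 16 * quadratic_const <= C.
  by rewrite /C /threshold_const -/A; move: (quadratic_const) => q; lra.
have CA : 32 * hi ^+ 2 * A ^+ 2 / lo <= C.
  by rewrite /C /threshold_const -/A; move: (quadratic_const) K2 => q K2; lra.
have e2 : quadratic_const * X <= Y.
  rewrite -(ler_pM2l C0).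
  have a1 : quadratic_const * (X * C) <= quadratic_const * (16 * Y) by rewrite ler_wpM2l.
  have a2 : 16 * quadratic_const * Y <= C * Y by rewrite ler_pM2r.
  by lra.
have e3 : 32 * hi ^+ 2 * A ^+ 2 / lo / C * Y <= Y.
  by rewrite ler_piMl ?(ltW Y0)// ler_pdivrMr// mul1r.
have zb : 0 <= lo * z ^+ 2 * b2 by rewrite !mulr_ge0// ltW.
have k1 : quartic_const * X ^+ 2 = 640 * hi ^+ 4 / lo * X ^+ 2 + 16 * hi ^+ 3 * X ^+ 2.
  by rewrite mulrDl.
have k2 : quadratic_const * X = 512 * hi ^+ 4 / lo * X + 256 * hi ^+ 2 / lo * X + (16 * hi ^+ 3 + 8 * hi * m) * X.
  by rewrite /quadratic_const; ring.
move: hmain hNT hGb hr' hqP2 hgP hPG' hG' e1 e2 e3 zb k1 k2.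
clearbody Y A C; clear - Y0.
move: (hi ^+ 2 * r2 / (lo / 4 * z ^+ 2)) (32 * hi ^+ 2 * A ^+ 2 / lo / C * Y) => T4 T6.
move: (2 * (A / sigma) * qP ^+ 2) (4 * z * g * (P2 + m)) => T3 T2.
move: (256 / lo * (P2 * G2)) (256 / lo * G2) quartic_const quadratic_const => T5 T1 q q'.
lra.
Qed.

End constants.

(** * The test function and its jets *)

Section row_jets.
Variables (R : realType) (n : nat).
Implicit Types (Phi Psi : R -> 'rV[R]_n) (A B C : 'rV[R]_n).

Definition rjet2 Phi A B C : Prop :=
  forall k, jet2 (fun t => Phi t 0 k) (A 0 k) (B 0 k) (C 0 k).

Lemma rjet2_affine A B : rjet2 (fun t => A + t *: B) A B 0.
Proof.
move=> k; apply: (jet2_eq (jet2D (jet2_cst (A 0 k)) (jet2M (@jet2_id R) (jet2_cst (B 0 k))))) => [t|||];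
  by rewrite ?mxE; ring.
Qed.

Lemma rjet2B Phi A B C A' : rjet2 Phi A B C -> rjet2 (fun t => Phi t - A') (A - A') B C.
Proof.
move=> h k; apply: (jet2_eq (jet2D (h k) (jet2_cst (- A' 0 k)))) => [t|||];
  by rewrite ?mxE ?addr0.
Qed.

Lemma jet2_dot Phi Psi A B C A' B' C' : rjet2 Phi A B C -> rjet2 Psi A' B' C' ->
  jet2 (fun t => dot (Phi t) (Psi t)) (dot A A') (dot A B' + dot B A')
    (dot A C' + 2 * dot B B' + dot C A').
Proof.
move=> h h'; apply: (jet2_eq (jet2_sum (fun k => jet2M (h k) (h' k)))) => //.
- by rewrite big_split.
- rewrite !big_split mulr_sumr; congr (_ + _ + _).
  by apply: eq_bigr => k _; rewrite mulrA.
Qed.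

Lemma jet2_dotl Phi A B C P : rjet2 Phi A B C ->
  jet2 (fun t => dot P (Phi t)) (dot P A) (dot P B) (dot P C).
Proof.
move=> h; have hP : rjet2 (fun=> P) P 0 0 by move=> k; rewrite mxE; exact: jet2_cst.
by apply: (jet2_eq (jet2_dot hP h)) => //; rewrite !dot0l ?addr0 ?mulr0 ?addr0.
Qed.

End row_jets.

Section second_derivatives.
Variables (R : realType) (n : nat) (v : 'rV[R]_n -> R).
Implicit Types x y xi : 'rV[R]_n.

(** The vector [D^2 v . xi]. *)
Definition hess x xi : 'rV[R]_n := \row_k dot (grad (partial k v) x) xi.

(** The vector [D^3 v (xi, xi, .)]. *)
Definition third x xi : 'rV[R]_n := \row_k hess_form (partial k v) x xi.

Lemma hessD x xi eta : hess x (xi + eta) = hess x xi + hess x eta.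
Proof. by apply/rowP => k; rewrite !mxE dotDr. Qed.

Lemma hess_formE x xi : hess_form v x xi = dot xi (hess x xi).
Proof. by apply: eq_bigr => k _; rewrite mxE. Qed.

Lemma hess_sum x xi a : dot a (hess x xi) =
  \sum_(i < n) \sum_(j < n) a 0 i * xi 0 j * partial j (partial i v) x.
Proof.
apply: eq_bigr => i _; rewrite mxE mulr_sumr; apply: eq_bigr => j _.
by rewrite mxE; ring.
Qed.

Variable U : set 'rV[R]_n.
Hypotheses (oU : open U) (hv : Ck_on 3 U v).

Lemma hess_sym x a b : U x -> dot a (hess x b) = dot b (hess x a).
Proof.
move=> Ux; rewrite !hess_sum exchange_big; apply: eq_bigr => i _.
apply: eq_bigr => j _; rewrite (schwarz _ _ oU (Ck_on_pred hv) Ux); ring.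
Qed.

Lemma rjet2_grad x xi : U x ->
  rjet2 (fun t => grad v (x + t *: xi)) (grad v x) (hess x xi) (third x xi).
Proof.
move=> Ux k; apply: (jet2_eq (jet2_line xi oU (Ck_on_partial k hv) Ux)) => [t|||];
  by rewrite ?mxE.
Qed.

End second_derivatives.

Section test_function.
Variables (R : realType) (n : nat) (lo hi : R) (F v : 'rV[R]_n -> R) (U : set 'rV[R]_n).
Hypotheses (lo0 : 0 <= lo) (lohi : lo <= hi) (hF : quad_convex lo hi F).
Hypotheses (oU : open U) (hv : Ck_on 3 U v).
Variables (e : 'rV[R]_n) (alpha M kappa hstar : R).
Hypotheses (M0 : 0 <= M) (kappa0 : 0 <= kappa).

Definition cutoff (y : 'rV[R]_n) : R := 4 - dot y y.

Definition bregman (p : 'rV[R]_n) : R := F p - F e - dot (grad F e) (p - e).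

(** The first term is the quantity to be bounded. The second is small by flatness of
    [v] and its second derivative along [grad F] is large where the gradient of [v]
    differs from [e]. The third penalises the region [F (grad v) < hstar], on
    which convexity alone gives no control of that derivative. *)
Definition test_fun (y : 'rV[R]_n) : R :=
  cutoff y ^+ 2 * bregman (grad v y) + alpha * (v y - dot e y) ^+ 2
  - M * expR (- (kappa * (F (grad v y) - hstar))).

(** [F (grad v)] need not be twice differentiable. Near [c] it lies above the paraboloid
    [F p + P . (grad v - p) + lo/2 |grad v - p|^2], with equality at [c], and [test_fun]
    is nondecreasing in this quantity; so the function [W] with the paraboloid in place
    of [F (grad v)] also has a local maximum at [c], and its second order jets exist. *)
Lemma touching_jets (c xi : 'rV[R]_n) : U c -> nbhs c (fun y => test_fun y <= test_fun c) ->
  let p := grad v c in let P := grad F p in let G := P - grad F e in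
  let z := cutoff c in let g := bregman p in let s := v c - dot e c in
  let E := expR (- (kappa * (F p - hstar))) in
  let N := z ^+ 2 *: G + (M * kappa * E) *: P in
  let r := (4 * z * g) *: c - (2 * alpha * s) *: (p - e) in
  let b := hess v c xi in
  dot N b = dot r xi /\
  dot N (third v c xi) + z ^+ 2 * lo * dot b b - 8 * z * dot c xi * dot G b
   + (8 * dot c xi ^+ 2 - 4 * z * dot xi xi) * g
   + 2 * alpha * dot (p - e) xi ^+ 2 + 2 * alpha * s * dot xi b
   + M * E * kappa * (lo * dot b b - kappa * dot P b ^+ 2) <= 0.
Proof.
move=> Uc hmax p P G z g s E N r b.
pose L (t : R) : R := F p + (dot P (grad v (c + t *: xi) - p)
   + lo / 2 * dot (grad v (c + t *: xi) - p) (grad v (c + t *: xi) - p)).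
pose W (t : R) : R := (cutoff (c + t *: xi) * cutoff (c + t *: xi)) *
    (L t - F e - dot (grad F e) (grad v (c + t *: xi) - e))
  + alpha * ((v (c + t *: xi) - dot e (c + t *: xi)) * (v (c + t *: xi) - dot e (c + t *: xi)))
  - M * expR (- (kappa * (L t - hstar))).
have LF t : L t <= F (grad v (c + t *: xi)).
  have /andP[h _] := quad_convex_expansion lo0 lohi hF p (grad v (c + t *: xi)).
  by rewrite /L -/P; rewrite -/P in h; lra.
have c0 : c + 0 *: xi = c by rewrite scale0r addr0.
have L0 : L 0 = F p by rewrite /L c0 -/p subrr !dot0r mulr0 !addr0.
have W0 : W 0 = test_fun c by rewrite /W L0 c0 /test_fun /bregman -/p !expr2.
have Wle : \forall t \near (0 : R), W t <= W 0.
  have := line_near xi hmax; apply: filterS => t ht.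
  rewrite W0; apply: le_trans ht.
  rewrite /W /test_fun /bregman !expr2; apply: lerB; last first.
    rewrite ler_wpM2l// ler_expR lerN2 ler_wpM2l// lerD2r; exact: LF.
  rewrite lerD2r; apply: ler_wpM2l; first by rewrite -expr2 sqr_ge0.
  by rewrite !lerD2r; exact: LF.
have jg := rjet2_grad oU hv xi Uc.
have jgp := rjet2B p jg.
have jge := rjet2B e jg.
have jL := jet2D (jet2_cst (F p)) (jet2D (jet2_dotl P jgp) (jet2Z (lo / 2) (jet2_dot jgp jgp))).
have jx := rjet2_affine c xi.
have jz := jet2D (jet2_cst 4) (jet2N (jet2_dot jx jx)).
have jv := jet2D (jet2_line xi oU (Ck_on_pred hv) Uc) (jet2N (jet2_dotl e jx)).
have jB := jet2D (jet2D jL (jet2_cst (- F e))) (jet2N (jet2_dotl (grad F e) jge)).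
have jE := jet2_exp (jet2N (jet2Z kappa (jet2D jL (jet2_cst (- hstar))))).
have jW := jet2D (jet2D (jet2M (jet2M jz jz) jB) (jet2Z alpha (jet2M jv jv))) (jet2N (jet2Z M jE)).
have [] := jet2_max (jW : jet2 W _ _ _) Wle.
have gp : grad v c - p = 0 by rewrite subrr.
rewrite gp !dot0l !dot0r hess_formE -/b.
have -> : expR (- (kappa * (F p + (0 + lo / 2 * 0) - hstar))) = E.
  by rewrite mulr0 !addr0.
rewrite /N /r !(dotDl, dotNl, dotZl) -/p (dotC xi c) -/s.
have -> : g = F p - F e - dot (grad F e) (p - e) by [].
have -> : z = 4 - dot c c by [].
clearbody E s.
move: (third v c xi) => T.
move: (dot c c) (dot c xi) (dot P b) (dot P T) (dot (grad F e) b) (dot (grad F e) T) => cc cx Pb PT eb eT.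
move: (dot p xi) (dot e xi) (dot xi b) (dot b b) (dot xi xi) (F p) (F e) (dot (grad F e) (p - e)) => px ex xb bb xx Fp Fe ep.
move=> h1 h2; split.
  by apply/eqP; rewrite -subr_eq0; apply/eqP; rewrite -[RHS]h1; field.
apply: le_trans h2; rewrite le_eqVlt; apply/orP; left; apply/eqP.
by field.
Qed.

End test_function.

(** * The differentiated equation *)

Lemma dot_eq0 (R : realType) (n : nat) (x : 'rV[R]_n) : dot x x <= 0 -> x = 0.
Proof.
move=> h; apply/rowP => i; rewrite mxE; apply/eqP; rewrite -sqrf_eq0 eq_le sqr_ge0 andbT.
exact: le_trans (dot_entry_le x i) h.
Qed.

Lemma cauchy_schwarz (R : realType) (n : nat) (x y : 'rV[R]_n) :
  dot x y ^+ 2 <= dot x x * dot y y.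
Proof.
have [y0|y0] := leP (dot y y) 0.
  by rewrite (dot_eq0 y0) !dot0r mulr0 expr0n.
have := dot_ge0 (dot y y *: x - dot x y *: y).
rewrite !(dotBl, dotBr, dotZl, dotZr) (dotC y x).
move: (dot x y) (dot x x) (dot y y) y0 => xy xx yy y0 h.
by rewrite -subr_ge0 -(pmulr_rge0 _ y0); apply: le_trans h _; rewrite le_eqVlt; apply/orP; left; apply/eqP; ring.
Qed.

Lemma young (R : realType) (n : nat) (th : R) (x y : 'rV[R]_n) : 0 < th ->
  2 * dot x y <= th * dot x x + dot y y / th.
Proof.
move=> th0; have := dot_ge0 (th *: x - y).
rewrite !(dotBl, dotBr, dotZl, dotZr) (dotC y x).
move: (dot x y) (dot x x) (dot y y) => xy xx yy h.
have : 0 <= (th ^+ 2 * xx - 2 * th * xy + yy) / th.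
  by apply: divr_ge0; [move: h; lra|exact: ltW].
rewrite (_ : _ / th = th * xx + yy / th - 2 * xy); last by field; rewrite gt_eqF.
by rewrite subr_ge0.
Qed.

Lemma is_derive_right (R : realType) (phi : R -> R) (l : R) :
  is_derive (0 : R) (1 : R) phi l ->
  ((phi t - phi 0) / t @[t --> 0^'+] --> l) /\ (phi t @[t --> 0^'+] --> phi 0).
Proof.
move=> [d dE]; split.
  apply: cvg_dnbhs_at_right.
  have : (fun h : R => h^-1 *: ((phi \o shift 0) (h *: (1:R)) - phi 0)) @ 0^' --> l.
    by rewrite -dE; exact: d.
  rewrite (_ : (fun h : R => _) = (fun t => (phi t - phi 0) / t))//.
  by apply/funext => t /=; rewrite addr0 [t *: 1]mulr1 [_ *: _]mulrC.
apply: cvg_at_right_filter.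
by have /derivable1_diffP/differentiable_continuous := d.
Qed.

Lemma delta_double_sum (R : realType) (n : nat) (f : 'I_n -> 'I_n -> R) (i : 'I_n) :
  \sum_k \sum_j (delta_mx 0 i : 'rV[R]_n) 0 k * (delta_mx 0 i : 'rV[R]_n) 0 j * f k j = f i i.
Proof.
have E (h : 'I_n -> R) : \sum_j (delta_mx 0 i : 'rV[R]_n) 0 j * h j = h i.
  rewrite (bigD1 i)//= big1 ?addr0 ?mxE ?eqxx ?mul1r// => j ji.
  by rewrite mxE eqxx (negbTE ji) mul0r.
transitivity (\sum_k (delta_mx 0 i : 'rV[R]_n) 0 k * f k i); last exact: E.
apply: eq_bigr => k _; rewrite -(E (f k)) mulr_sumr.
by apply: eq_bigr => j _; rewrite mulrA.
Qed.

Lemma is_derive_trace_form (R : realType) (n : nat) (h : 'I_n -> 'I_n -> R -> R)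
    (d a : 'I_n -> 'I_n -> R) (k x : R) :
  (forall i j, is_derive x (1 : R) (h i j) (d i j)) ->
  is_derive x (1 : R) (fun t => \sum_i \sum_j a i j * h i j t + k * \sum_i h i i t)
    (\sum_i \sum_j a i j * d i j + k * \sum_i d i i).
Proof.
move=> hd.
have -> : (fun t => \sum_i \sum_j a i j * h i j t + k * \sum_i h i i t) =
    (\sum_i \sum_j (a i j *: h i j)) + k *: (\sum_i h i i).
  apply/funext => t; rewrite fctE fct_sumE; congr (_ + _).
  by rewrite fct_sumE; apply: eq_bigr => i _; rewrite fct_sumE.
exact: is_deriveD.
Qed.

Lemma cvg_young_bound (R : realType) (T : Type) (A : set_system T) (FA : Filter A)
    (f g m S : T -> R) (a b s th k : R) :
  f t @[t --> A] --> a -> g t @[t --> A] --> b -> m t @[t --> A] --> (0 : R) ->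
  S t @[t --> A] --> s ->
  th * f t + k * g t / th + k * g t * (m t * (1 + S t)) @[t --> A] --> th * a + k * b / th.
Proof.
move=> fa gb m0 Ss.
have E : th * a + k * b / th = th * a + k * b / th + k * b * (0 * (1 + s)) by ring.
rewrite [X in _ --> X]E; apply: cvgD; first apply: cvgD.
- by apply: cvgM => //; exact: cvg_cst.
- by apply: cvgM; [apply: cvgM => //; exact: cvg_cst|exact: cvg_cst].
- apply: cvgM; first by apply: cvgM => //; exact: cvg_cst.
  by apply: cvgM => //; apply: cvgD => //; exact: cvg_cst.
Qed.

Section pde_derivative.
Variables (R : realType) (n : nat) (lo hi eps : R) (F v : 'rV[R]_n -> R) (U : set 'rV[R]_n).
Hypotheses (lo0 : 0 <= lo) (lohi : lo <= hi) (hi0 : 0 < hi) (hF : quad_convex lo hi F).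
Hypotheses (oU : open U) (hv : Ck_on 3 U v).

Lemma aronssonE x : aronsson_eps F eps v x =
  dot (grad F (grad v x)) (hess v x (grad F (grad v x)))
  + eps * \sum_i partial i (partial i v) x.
Proof.
rewrite /aronsson_eps hess_sum; congr (_ + _).
by apply: eq_bigr => i _; apply: eq_bigr => j _; rewrite !mxE.
Qed.

Lemma partial_congr (f g : 'rV[R]_n -> R) x i : U x ->
  (forall y, U y -> f y = g y) -> partial i f x = partial i g x.
Proof.
move=> Ux fg; apply: near_eq_derive.
have [r r0 hr] := nbhs_norm (@open_nbhs_nbhs _ x U (conj oU Ux)).
apply/nbhs_ballP; exists r => // y; rewrite -ball_normE /= => yr.
by apply/fg/hr; rewrite distrC.
Qed.

Lemma hess_square x (a b : 'rV[R]_n) : U x ->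
  dot (a + b) (hess v x (a + b)) =
  dot a (hess v x a) + 2 * dot (hess v x a) b + dot b (hess v x b).
Proof.
move=> Ux; rewrite hessD !(dotDl, dotDr) (hess_sym oU hv a b Ux) (dotC (hess v x a) b).
by ring.
Qed.

Lemma third_sym x (i j k : 'I_n) : U x ->
  partial k (partial j (partial i v)) x = partial j (partial i (partial k v)) x.
Proof.
move=> Ux; rewrite (schwarz j k oU (Ck_on_partial i hv) Ux).
exact: (@partial_congr (partial k (partial i v)) (partial i (partial k v)) x j Ux
  (fun y Uy => schwarz i k oU (Ck_on_pred hv) Uy)).
Qed.

(** By symmetry of third derivatives [a] becomes the outermost direction, so that
    the left-hand side is recognised as part of a derivative along [a]. *)
Lemma dot_third x xi a : U x -> dot a (third v x xi) =
  \sum_(i < n) \sum_(j < n) xi 0 i * xi 0 j * dot (grad (partial j (partial i v)) x) a.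
Proof.
move=> Ux; transitivity (\sum_k \sum_i \sum_j
    a 0 k * (xi 0 i * xi 0 j * partial j (partial i (partial k v)) x)).
  apply: eq_bigr => k _; rewrite mxE mulr_sumr; apply: eq_bigr => i _.
  by rewrite !mulr_sumr; apply: eq_bigr => j _; rewrite mxE; ring.
rewrite exchange_big; apply: eq_bigr => i _; rewrite exchange_big; apply: eq_bigr => j _.
rewrite mulr_sumr; apply: eq_bigr => k _; rewrite mxE (@third_sym x i j k Ux).
by rewrite mulrC mulrA -!mulrA; congr (_ * (_ * _)); rewrite mulrC.
Qed.

Lemma dot_third_delta x i a : U x ->
  dot a (third v x (delta_mx 0 i)) = dot (grad (partial i (partial i v)) x) a.
Proof.
move=> Ux; rewrite (dot_third _ _ Ux).
exact: (delta_double_sum (fun k j => dot (grad (partial j (partial k v)) x) a) i).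
Qed.

Hypothesis pde : forall x, U x -> aronsson_eps F eps v x = 0.

(** Differentiating the equation in the direction [N] without assuming that
    [grad F] is differentiable: along the line [c + t N] the coefficient
    [grad F (grad v)] moves by at most [hi |hess v c N| t] to first order, so
    the one-sided difference quotients of the operator with constant coefficients
    [P] are bounded, by Young's inequality for the cross term, and the bound
    passes to the limit. *)
Lemma pde_derivative (c N : 'rV[R]_n) (th : R) : U c -> 0 < th ->
  let P := grad F (grad v c) in
  let b := hess v c P in
  let r := hess v c N in
  - (dot N (third v c P) + eps * \sum_i dot N (third v c (delta_mx 0 i)))
  <= th * dot b b + hi ^+ 2 * dot r r / th.
Proof.
move=> Uc th0; cbv zeta; set P := grad F (grad v c); set b := hess v c P; set r := hess v c N.
pose y (t : R) := c + t *: N.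
have y0 : y 0 = c by rewrite /y scale0r addr0.
pose Phi (t : R) : R := dot P (hess v (y t) P) + eps * \sum_i partial i (partial i v) (y t).
have Phi0 : Phi 0 = 0 by have := pde Uc; rewrite aronssonE /Phi y0.
have dline (f : 'rV[R]_n -> R) : Ck_on 1 U f ->
    is_derive (0 : R) (1 : R) (fun t => f (y t)) (dot (grad f c) N).
  by move=> hf; apply/is_derive_line; rewrite -/(y 0) y0; exact: (C1_is_derive oU hf).
have d2 i j : is_derive (0 : R) (1 : R) (fun t => partial j (partial i v) (y t))
    (dot (grad (partial j (partial i v)) c) N).
  by apply: dline; do 2 apply: Ck_on_partial.
have d1 i : is_derive (0 : R) (1 : R) (fun t => partial i v (y t)) (r 0 i).
  by rewrite mxE; apply: dline; exact: Ck_on_pred (Ck_on_partial i hv).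
have dPhi : is_derive (0 : R) (1 : R) Phi
    (dot N (third v c P) + eps * \sum_i dot N (third v c (delta_mx 0 i))).
  have -> : \sum_i dot N (third v c (delta_mx 0 i)) =
      \sum_i dot (grad (partial i (partial i v)) c) N.
    by apply: eq_bigr => i _; rewrite (dot_third_delta _ _ Uc).
  rewrite (dot_third _ _ Uc).
  have -> : Phi = (fun t => \sum_i \sum_j P 0 i * P 0 j * partial j (partial i v) (y t)
      + eps * \sum_i partial i (partial i v) (y t)).
    by apply/funext => t; rewrite /Phi hess_sum.
  exact: (is_derive_trace_form (fun i j => P 0 i * P 0 j) eps d2).
pose X t : 'rV[R]_n := hess v (y t) P.
pose S t : R := \sum_k dot (grad (partial k v) (y t)) (grad (partial k v) (y t)).
pose q t : 'rV[R]_n := t^-1 *: (grad v (y t) - grad v c).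
have cX i : X t 0 i @[t --> 0^'+] --> b 0 i.
  have -> : (fun t => X t 0 i) = (fun t => dot (grad (partial i v) (y t)) P).
    by apply/funext => t; rewrite mxE.
  rewrite mxE; apply: cvg_dot => [j|j]; last exact: cvg_cst.
  have := (is_derive_right (d2 i j)).2; rewrite y0.
  by under [in X in _ -> X]eq_fun do rewrite mxE; rewrite mxE.
have cS : S t @[t --> 0^'+] --> S 0.
  apply: cvg_big => [|k _]; first exact: add_continuous.
  by apply: cvg_dot => i; have := (is_derive_right (d2 k i)).2;
    under [in X in _ -> X]eq_fun do rewrite mxE; rewrite mxE.
have cq i : q t 0 i @[t --> 0^'+] --> r 0 i.
  have := (is_derive_right (d1 i)).1; rewrite y0.
  rewrite (_ : (fun t => q t 0 i) = (fun t => (partial i v (y t) - partial i v c) / t))//.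
  by apply/funext => t; rewrite !mxE mulrC.
have c1 := (is_derive_right dPhi).1.
have c2 : dot (X t) (X t) @[t --> 0^'+] --> dot b b by exact: cvg_dot.
have c3 : dot (q t) (q t) @[t --> 0^'+] --> dot r r by exact: cvg_dot.
have ct : t @[t --> (0 : R)^'+] --> (0 : R) by apply: cvg_at_right_filter; exact: cvg_id.
have cL : - ((Phi t - Phi 0) / t) @[t --> 0^'+] -->
   - (dot N (third v c P) + eps * \sum_i dot N (third v c (delta_mx 0 i))).
  exact: cvgN.
have cR : th * dot (X t) (X t) + hi ^+ 2 * dot (q t) (q t) / th
    + hi ^+ 2 * dot (q t) (q t) * (t * (1 + S t)) @[t --> 0^'+] -->
    th * dot b b + hi ^+ 2 * dot r r / th.
  exact: (@cvg_young_bound R R (0^'+) _ (fun t => dot (X t) (X t)) (fun t => dot (q t) (q t))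
  (fun t => t) S _ _ _ th (hi ^+ 2) c2 c3 ct cS).
apply: (ler_cvg_to cL cR).
have nU : \forall t \near (0 : R)^'+, U (y t).
  have /nbhs_ballP[d /= d0 hd] := line_near N (@open_nbhs_nbhs _ c U (conj oU Uc)).
  near=> t; apply: hd; rewrite -ball_normE /= sub0r normrN gtr0_norm; first by near: t; exact: nbhs_right_lt.
  by near: t; exact: nbhs_right_gt.
near=> t.
have t0 : 0 < t by near: t; exact: nbhs_right_gt.
have Ut : U (y t) by near: t.
rewrite Phi0 subr0.
have := pde Ut; rewrite aronssonE.
have [D PD hD] : exists2 D, grad F (grad v (y t)) = P + D &
    dot D D <= hi ^+ 2 * (t ^+ 2 * dot (q t) (q t)).
  exists (grad F (grad v (y t)) - P); first by rewrite addrC subrK.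
  apply: le_trans (grad_lipschitz lo0 lohi hF _ _ hi0) _.
  rewrite ler_wpM2l ?sqr_ge0// /q dotZl dotZr.
  move: (dot _ _) => X2; rewrite le_eqVlt; apply/orP; left; apply/eqP.
  by field; rewrite gt_eqF.
rewrite PD (hess_square _ _ Ut) -/(X t) => E.
have h1 := young (X t) D (mulr_gt0 t0 th0).
have S0 : 0 <= S t by apply: sumr_ge0 => k _; exact: dot_ge0.
have h2 : dot D (hess v (y t) D) <= dot D D * (1 + S t).
  have hH : dot (hess v (y t) D) (hess v (y t) D) <= S t * dot D D.
    rewrite mulr_suml; apply: ler_sum => k _; rewrite mxE -expr2.
    exact: cauchy_schwarz.
  have := young D (hess v (y t) D) ltr01.
  have : 0 <= dot D D * (1 + S t) by rewrite mulr_ge0 ?dot_ge0// addr_ge0.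
  move: hH; move: (dot D D) (dot D _) (dot _ _) (S t) => DD DH HH St; lra.
have h3 : dot D D / (t * th) <= t * (hi ^+ 2 * dot (q t) (q t) / th).
  rewrite ler_pdivrMr ?mulr_gt0//; apply: le_trans hD _; rewrite le_eqVlt; apply/orP; left.
  by apply/eqP; field; rewrite gt_eqF.
have h4 : dot D D * (1 + S t) <= hi ^+ 2 * (t ^+ 2 * dot (q t) (q t)) * (1 + S t).
  by rewrite ler_wpM2r// addr_ge0.
rewrite -mulNr ler_pdivrMr//.
have -> : - Phi t = 2 * dot (X t) D + dot D (hess v (y t) D).
  by apply/eqP; rewrite eq_sym -subr_eq0 opprK -[X in _ == X]E /Phi -/(X t); apply/eqP; ring.
move: h1 h2 h3 h4; clear.
move: (dot (X t) (X t)) (dot (X t) D) (dot D D) (dot D _) (dot (q t) (q t)) (S t) => XX XD DD DH Q St.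
lra.
Unshelve. all: by end_near. Qed.

End pde_derivative.

(** * Exclusion of interior maxima *)

Section min_at_zero.
Variables (R : realType) (n : nat) (lo hi : R) (F : 'rV[R]_n -> R).
Hypotheses (lo0 : 0 < lo) (lohi : lo <= hi) (hF : quad_convex lo hi F).
Hypotheses (F0 : F 0 = 0) (Fge0 : forall p, 0 <= F p).

Let hi0 : 0 < hi. Proof. exact: lt_le_trans lohi. Qed.

(** Otherwise a gradient step from [0] would reach negative values. *)
Lemma grad_at_min : grad F 0 = 0.
Proof.
apply: dot_eq0; set g := grad F 0.
have /andP[_ h] := quad_convex_expansion (ltW lo0) lohi hF 0 (- (hi^-1 *: g)).
have := Fge0 (- (hi^-1 *: g)); move: h.
rewrite F0 !subr0 -/g !(dotNl, dotNr, dotZl, dotZr) opprK.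
move: (F _) (dot g g) => a d h a0.
have E : hi / 2 * (hi^-1 * (hi^-1 * d)) = hi^-1 * d / 2 by field; rewrite gt_eqF.
have : hi^-1 * d <= 0 by move: h; rewrite ?mulrN ?opprK E; lra.
by rewrite pmulr_rle0// invr_gt0.
Qed.

Lemma min_lower_bound p : lo / 2 * dot p p <= F p.
Proof.
have /andP[h _] := quad_convex_expansion (ltW lo0) lohi hF 0 p.
by move: h; rewrite grad_at_min dot0l F0 !subr0.
Qed.

Lemma min_upper_bound p : F p <= hi / 2 * dot p p.
Proof.
have /andP[_ h] := quad_convex_expansion (ltW lo0) lohi hF 0 p.
by move: h; rewrite grad_at_min dot0l F0 !subr0.
Qed.

Lemma min_grad_bound p : dot (grad F p) (grad F p) <= hi ^+ 2 * dot p p.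
Proof.
have := grad_lipschitz (ltW lo0) lohi hF 0 p hi0.
by rewrite grad_at_min !subr0.
Qed.

End min_at_zero.

Lemma dot_deltal (R : realType) (n : nat) (x : 'rV[R]_n) i : dot (delta_mx 0 i) x = x 0 i.
Proof.
rewrite /dot (bigD1 i)//= big1 ?addr0 ?mxE ?eqxx ?mul1r// => j ji.
by rewrite mxE eqxx (negbTE ji) mul0r.
Qed.

Lemma dot_deltar (R : realType) (n : nat) (x : 'rV[R]_n) i : dot x (delta_mx 0 i) = x 0 i.
Proof. by rewrite dotC dot_deltal. Qed.

Lemma sum_sqr_le (R : realType) (n : nat) (f : 'I_n -> R) :
  (\sum_i f i) ^+ 2 <= n%:R * \sum_i f i ^+ 2.
Proof.
have := cauchy_schwarz (\row_(i < n) (1 : R)) (\row_i f i).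
have -> : dot (\row_(i < n) (1 : R)) (\row_i f i) = \sum_i f i.
  by apply: eq_bigr => i _; rewrite !mxE mul1r.
have -> : dot (\row_(i < n) (1 : R)) (\row_(i < n) (1 : R)) = n%:R.
  by rewrite /dot; under eq_bigr do rewrite !mxE mul1r; rewrite sumr_const card_ord.
have -> // : dot (\row_i f i) (\row_i f i) = \sum_i f i ^+ 2.
by apply: eq_bigr => i _; rewrite !mxE expr2.
Qed.

Lemma dot_subD_le (R : realType) (n : nat) (x y : 'rV[R]_n) :
  dot (x - y) (x - y) <= 2 * dot x x + 2 * dot y y.
Proof.
have := dot_ge0 (x + y); rewrite !(dotDl, dotDr, dotNl, dotNr) (dotC y x).
by move: (dot x y) (dot x x) (dot y y) => a b c; lra.
Qed.

Lemma sum_combination (R : realType) (n : nat) (a c t d b : 'I_n -> R) (k1 k2 k3 k4 K l : R) :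
  (forall i, a i - k1 * c i - k2 + k3 * t i + K * (l * d i - k4 * b i) <= 0) ->
  \sum_i a i - k1 * (\sum_i c i) - k2 * n%:R + k3 * (\sum_i t i)
    + K * (l * (\sum_i d i) - k4 * (\sum_i b i)) <= 0.
Proof.
move=> h; have := @sumr_le0 _ _ (index_enum 'I_n) xpredT _ (fun i _ => h i).
have -> : \sum_i (a i - k1 * c i - k2 + k3 * t i + K * (l * d i - k4 * b i)) =
  \sum_i (a i + (- k1) * c i + (- k2) + k3 * t i + (K * l) * d i + (- K * k4) * b i).
  by apply: eq_bigr => i _; ring.
rewrite !big_split -!mulr_sumr sumr_const card_ord -mulr_natr /=.
by apply: le_trans; rewrite le_eqVlt; apply/orP; left; apply/eqP; ring.
Qed.

(** Second order condition in one coordinate direction: Young's inequality takes care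
    of the mixed term [c * Gb], and the two squares have the good sign. *)
Lemma coordinate_bound (R : realFieldType) (z c g al s q t d Gb GG a k l : R) :
  0 <= z ^+ 2 * l * d -> 0 <= c ^+ 2 * g -> 0 <= al * q ^+ 2 ->
  2 * (z * (4 * c * Gb)) <= l / 4 * (z * (z * d)) + GG ->
  a - GG - 4 * z * g + 2 * al * s * t + k <=
  a + z ^+ 2 * l * d - 8 * z * c * Gb + (8 * c ^+ 2 - 4 * z * 1) * g
    + 2 * al * q ^+ 2 + 2 * al * s * t + k.
Proof. lra. Qed.

(** Adds the second order condition along [P], with weight [1], to those along the
    coordinate directions, with weight [eps]. These are the weights of the equation,
    which therefore cancels the terms in [al * s]. *)
Lemma combine_directions (R : realFieldType)
    (NP Ns z l bb cP Gb PP g al qP s Pb tr K kap SB GG cc nn eps l64 : R) :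
  0 < eps -> eps <= 1 -> 0 <= z -> 0 <= g -> 0 <= nn -> 0 <= l64 * GG -> 0 <= cc -> cc <= 4 ->
  0 <= K -> Pb + eps * tr = 0 ->
  0 <= l * bb - kap * Pb ^+ 2 + eps * (l * SB - kap * bb) ->
  NP + z ^+ 2 * l * bb - 8 * z * cP * Gb + (8 * cP ^+ 2 - 4 * z * PP) * g
    + 2 * al * qP ^+ 2 + 2 * al * s * Pb + K * (l * bb - kap * Pb ^+ 2) <= 0 ->
  Ns - l64 * GG * cc - 4 * z * g * nn + 2 * al * s * tr + K * (l * SB - kap * bb) <= 0 ->
  NP + eps * Ns + z ^+ 2 * l * bb - 8 * z * (cP * Gb) - 4 * (l64 * GG)
    - 4 * z * g * (PP + nn) + 2 * al * qP ^+ 2 <= 0.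
Proof.
move=> e0 e1 z0 g0 n0 l0 c0 c4 K0 pde0 hexp hP hs.
have f1 := mulr_ge0_le0 (ltW e0) hs.
have f2 : 0 <= cP ^+ 2 * g by rewrite mulr_ge0// sqr_ge0.
have f3 : eps * (l64 * GG * cc) <= 4 * (l64 * GG).
  have a1 : l64 * GG * cc <= l64 * GG * 4 by rewrite ler_wpM2l.
  have a2 : eps * (l64 * GG * cc) <= 1 * (l64 * GG * cc) by rewrite ler_wpM2r// mulr_ge0.
  by lra.
have f4 : eps * (4 * z * g * nn) <= 4 * z * g * nn.
  by rewrite ler_piMl// !mulr_ge0.
have f5 : al * s * Pb + al * s * (eps * tr) = 0 by rewrite -mulrDr pde0 mulr0.
have f6 := mulr_ge0 K0 hexp.
lra.
Qed.

(** [P . (p - e) >= F p - F e + lo/2 X], and the loss [F e - F p <= 2 delta] is absorbed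
    because [X >= 8 sigma / lo]. *)
Lemma descent_bound (R : realFieldType) (lo sigma delta X t Fp Fe : R) :
  0 < lo -> delta <= sigma -> 128 / lo * sigma <= 16 * X ->
  lo / 2 * X <= Fe - Fp - t -> Fe - 2 * delta <= Fp -> lo / 4 * X <= - t.
Proof.
move=> lo0 ds h1 h good.
have : lo * (128 / lo * sigma) <= lo * (16 * X) by rewrite ler_wpM2l// ltW.
rewrite (_ : lo * (128 / lo * sigma) = 128 * sigma); last by field; rewrite gt_eqF.
move=> h2; lra.
Qed.

Lemma young_rescale (R : realFieldType) (z x1 x2 x3 x4 x5 l k : R) :
  2 * (z * (4 * x1 * x2)) <= l / 4 * (z * (z * x3)) + 64 / k * x5 ->
  64 / k * x5 <= 64 / k * (4 * x4) ->
  8 * z * (x1 * x2) <= l / 4 * z ^+ 2 * x3 + 256 / k * x4.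
Proof. lra. Qed.

Section no_interior_max.
Variables (R : realType) (n : nat) (lo hi eps mu : R) (F v : 'rV[R]_n -> R) (U : set 'rV[R]_n).
Hypotheses (lo0 : 0 < lo) (lohi : lo <= hi) (hF : quad_convex lo hi F).
Hypotheses (F0 : F 0 = 0) (Fge0 : forall p, 0 <= F p).
Hypotheses (oU : open U) (hv : Ck_on 3 U v).
Hypotheses (eps0 : 0 < eps) (eps1 : eps <= 1).
Hypothesis pde : forall x, U x -> aronsson_eps F eps v x = 0.
Hypotheses (mu0 : 0 <= mu) (mulo : mu <= lo) (munlo : mu * n%:R <= lo).
Variables (e : 'rV[R]_n) (sigma tau delta M : R).
Hypotheses (e1 : dot e e = 1) (M0 : 0 <= M).
Hypotheses (sigma0 : 0 < sigma) (sigmaS : sigma <= 1 + hi / 4).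
Hypotheses (taus : tau <= sigma) (deltas : delta <= sigma).
Hypothesis flat : forall y, U y -> `|v y - dot e y| <= tau.

Notation A := (weight_const lo hi).
Notation thr := (threshold_const lo hi n%:R).
Notation w := (test_fun F v e (A / sigma) M (mu / eps) (F e - 2 * delta)).

Let hi0 : 0 < hi. Proof. exact: lt_le_trans lohi. Qed.

(** The first order conditions say [D^2 v . N = r], with [r] explicit; hence the third
    derivatives in the summed second order conditions, which are those of the equation
    differentiated along [N], are controlled by [pde_derivative] with no further
    knowledge of the Hessian. Everything then depends on scalars only. *)
Lemma no_interior_max (c : 'rV[R]_n) : U c -> dot c c < 4 ->
  nbhs c (fun y => w y <= w c) ->
  F e - 2 * delta <= F (grad v c) ->
  thr * sigma <= cutoff c ^+ 2 * dot (grad v c - e) (grad v c - e) -> False.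
Proof.
move=> Uc c4 hmax good big.
have kappa0 : 0 <= mu / eps by rewrite divr_ge0// ltW.
have tj xi := touching_jets (ltW lo0) lohi hF oU hv M0 kappa0 xi Uc hmax.
have A0 : 0 < A by exact: weight_const_gt0.
have thr0 : 0 < thr by apply: threshold_const_gt0.
cbv zeta in tj.
set p := grad v c in tj big good *; set P := grad F p in tj; set G := P - grad F e in tj.
set z := cutoff c in tj big; set g := bregman F e p in tj; set s := v c - dot e c in tj.
set E := expR _ in tj; set q := p - e in tj big.
set N := _ + (M * (mu / eps) * E) *: P in tj.
set r := _ - (2 * (A / sigma) * s) *: q in tj.
have E0 : 0 <= E by exact: expR_ge0.
have c0 := dot_ge0 c.
have z0 : 0 < z by rewrite subr_gt0.
have z4 : z <= 4 by rewrite /z /cutoff; lra.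
have X0 := dot_ge0 q.
have gE : lo / 2 * dot q q <= g <= hi / 2 * dot q q.
  exact: (quad_convex_expansion (ltW lo0) lohi hF e p).
have /andP[gl gu] := gE.
have g0 : 0 <= g by apply: le_trans gl; rewrite mulr_ge0// divr_ge0// ltW.
have GX : dot G G <= hi ^+ 2 * dot q q by exact: (grad_lipschitz (ltW lo0) lohi hF e p hi0).
have P2 : dot P P <= hi ^+ 2 * (2 * dot q q + 2).
  apply: le_trans (min_grad_bound lo0 lohi hF F0 Fge0 p) _.
  rewrite ler_pM2l ?exprn_gt0//.
  have -> : p = q - (- e) by rewrite opprK subrK.
  by apply: le_trans (dot_subD_le _ _) _; rewrite dotNl dotNr opprK e1 mulr1.
pose b := hess v c P.
have HN : hess v c N = r.
  apply/rowP => i; rewrite -dot_deltal (hess_sym oU hv _ _ Uc).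
  by rewrite (tj (delta_mx 0 i)).1 dot_deltar.
have bE i : dot P (hess v c (delta_mx 0 i)) = b 0 i.
  by rewrite (hess_sym oU hv _ _ Uc) dot_deltal.
pose bi i := hess v c (delta_mx 0 i).
pose SB := \sum_i dot (bi i) (bi i).
pose tr := \sum_i (bi i) 0 i.
pose K := M * E * (mu / eps).
have K0 : 0 <= K := mulr_ge0 (mulr_ge0 M0 E0) kappa0.
(* Young absorbs the mixed term 8 z c_i (G . b_i), which comes from differentiating
   the cutoff once, into a quarter of the good term z^2 lo |b_i|^2. *)
have coord_le i : dot N (third v c (delta_mx 0 i)) - 64 / lo * c 0 i ^+ 2 * dot G G - 4 * z * g
    + 2 * (A / sigma) * s * bi i 0 i
    + K * (lo * dot (bi i) (bi i) - mu / eps * b 0 i ^+ 2) <= 0.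
  apply: le_trans (tj (delta_mx 0 i)).2.
  have dd : dot (delta_mx 0 i : 'rV[R]_n) (delta_mx 0 i) = 1 by rewrite dot_deltal mxE !eqxx.
  rewrite -/(bi i) bE dd !dot_deltar dot_deltal.
  have lo4 : 0 < lo / 4 by rewrite divr_gt0.
  have := young (z *: bi i) ((4 * c 0 i) *: G) lo4.
  rewrite !(dotZl, dotZr) (dotC (bi i) G).
  have -> : 4 * c 0 i * (4 * c 0 i * dot G G) / (lo / 4) = 64 / lo * c 0 i ^+ 2 * dot G G.
    by field; rewrite gt_eqF.
  have zb : 0 <= z ^+ 2 * lo * dot (bi i) (bi i).
    by rewrite mulr_ge0 ?dot_ge0// mulr_ge0 ?sqr_ge0// ltW.
  have cg : 0 <= c 0 i ^+ 2 * g by rewrite mulr_ge0// sqr_ge0.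
  have qa : 0 <= A / sigma * q 0 i ^+ 2 by rewrite mulr_ge0 ?sqr_ge0// divr_ge0// ltW.
  move=> yg; exact: coordinate_bound.
have hsum : \sum_i dot N (third v c (delta_mx 0 i)) - 64 / lo * dot G G * dot c c
    - 4 * z * g * n%:R + 2 * (A / sigma) * s * tr + K * (lo * SB - mu / eps * dot b b) <= 0.
  have dE (x : 'rV[R]_n) : dot x x = \sum_i x 0 i ^+ 2.
    by apply: eq_bigr => i _; rewrite expr2.
  rewrite (dE c) (dE b); apply: sum_combination => i.
  by have := coord_le i; rewrite [_ * _ * dot G G]mulrAC.
have [hN1 hP] := tj P; move: hP; rewrite -/b -/K => hP.
have pdeE : dot P b + eps * tr = 0.
  have h := pde Uc; rewrite aronssonE -/p -/P -/b in h; rewrite -[RHS]h; congr (_ + eps * _).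
  by apply: eq_bigr => i _; rewrite !mxE dot_deltar mxE.
have trSB : tr ^+ 2 <= n%:R * SB.
  apply: le_trans (sum_sqr_le _) _; rewrite ler_wpM2l//.
  by apply: ler_sum => i _; exact: dot_entry_le.
have SB0 : 0 <= SB by apply: sumr_ge0 => i _; exact: dot_ge0.
have b2 := dot_ge0 b.
(* By the equation P . b = - eps tr, and tr^2 <= n SB; so the two negative squares
   are paid for by the Hessian terms as soon as mu n <= lo. *)
have hexp : 0 <= lo * dot b b - mu / eps * dot P b ^+ 2 + eps * (lo * SB - mu / eps * dot b b).
  have -> : dot P b = - (eps * tr) by apply/eqP; rewrite -subr_eq0 opprK pdeE.
  have -> : mu / eps * (- (eps * tr)) ^+ 2 = eps * (mu * tr ^+ 2) by field; rewrite gt_eqF.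
  have -> : eps * (lo * SB - mu / eps * dot b b) = eps * (lo * SB) - mu * dot b b.
    by field; rewrite gt_eqF.
  have h1 : mu * tr ^+ 2 <= lo * SB.
    apply: le_trans (ler_wpM2l mu0 trSB) _; rewrite mulrA; exact: ler_wpM2r.
  have h2 : mu * dot b b <= lo * dot b b by exact: ler_wpM2r.
  have h3 : eps * (mu * tr ^+ 2) <= eps * (lo * SB) by rewrite ler_pM2l.
  lra.
have G20 := dot_ge0 G; have P20 := dot_ge0 P.
pose NT := dot N (third v c P) + eps * \sum_i dot N (third v c (delta_mx 0 i)).
have l64 : 0 <= 64 / lo * dot G G by rewrite mulr_ge0// divr_ge0// ltW.
have hmain := combine_directions eps0 eps1 (ltW z0) g0 (ler0n _ n) l64 c0 (ltW c4) K0 pdeE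
  hexp hP hsum.
rewrite -/NT in hmain.
have z2 : 0 < z ^+ 2 by rewrite exprn_gt0.
have th0 : 0 < lo / 4 * z ^+ 2 by rewrite mulr_gt0// divr_gt0.
have lo4 : 0 < lo / 4 by rewrite divr_gt0.
apply: (@interior_absurd R lo hi n%:R lo0 hi0 (ler0n _ _) sigma z (dot q q) g NT
  (dot b b) (dot c P * dot G b) (dot P P) (dot G G) (dot r r) (dot q P)) => //.
- have /andP[h _] := quad_convex_expansion (ltW lo0) lohi hF p e.
  have dq : dot q P = - dot P (e - p) by rewrite -dotNr opprB dotC.
  have dqq : dot (e - p) (e - p) = dot q q by rewrite -opprB dotNl dotNr opprK.
  rewrite -/P dqq in h.
  have thr128 : 128 / lo <= thr.
    rewrite /threshold_const lerDr addr_ge0//; last exact: hiA_term_ge0.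
    by rewrite mulr_ge0// quadratic_const_ge0.
  have h1 : 128 / lo * sigma <= 16 * dot q q.
    apply: le_trans (_ : thr * sigma <= _); first by rewrite ler_pM2r.
    apply: le_trans big _; rewrite ler_wpM2r// (_ : 16 = 4 ^+ 2); last by ring.
    by rewrite ler_pXn2r// nnegrE// ltW.
  rewrite dq; exact: (descent_bound lo0 deltas h1 h good).
- apply: le_trans (dot_subD_le _ _) _; rewrite !(dotZl, dotZr).
  have hs : s ^+ 2 <= sigma ^+ 2.
    rewrite -[leLHS]real_normK ?num_real// ler_pXn2r ?nnegrE ?(ltW sigma0)//.
    exact: le_trans (flat Uc) taus.
  have -> : 2 * (2 * (A / sigma) * s * (2 * (A / sigma) * s * dot q q)) =
      8 * A ^+ 2 * dot q q * (s ^+ 2 / sigma ^+ 2) by field; rewrite gt_eqF.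
  have -> : 2 * (4 * z * g * (4 * z * g * dot c c)) = 32 * (z ^+ 2 * g ^+ 2) * dot c c by ring.
  apply: lerD.
    rewrite (_ : 128 * z ^+ 2 * g ^+ 2 = 32 * (z ^+ 2 * g ^+ 2) * 4); last by ring.
    by rewrite ler_wpM2l ?(ltW c4)// mulr_ge0// mulr_ge0// sqr_ge0.
  rewrite ler_piMr//; first by rewrite mulr_ge0// mulr_ge0// sqr_ge0.
  by rewrite ler_pdivrMr ?exprn_gt0// mul1r.
- have := pde_derivative (ltW lo0) lohi hi0 hF oU hv pde N Uc th0.
  by cbv zeta; rewrite -/p -/P -/b HN.
- have := young (z *: b) ((4 * dot c P) *: G) lo4.
  rewrite !(dotZl, dotZr) (dotC b G).
  have -> : 4 * dot c P * (4 * dot c P * dot G G) / (lo / 4) = 64 / lo * (dot c P ^+ 2 * dot G G).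
    by field; rewrite gt_eqF.
  have h1 : dot c P ^+ 2 * dot G G <= 4 * (dot P P * dot G G).
    rewrite mulrA ler_wpM2r//; apply: le_trans (cauchy_schwarz _ _) _.
    by rewrite ler_wpM2r// ltW.
  have h2 : 64 / lo * (dot c P ^+ 2 * dot G G) <= 64 / lo * (4 * (dot P P * dot G G)).
    by rewrite ler_wpM2l// divr_ge0// ltW.
  move=> h3; exact: (young_rescale h3 h2).
- by move: hmain; rewrite (_ : 4 * (64 / lo * dot G G) = 256 / lo * dot G G)//; ring.
Qed.

End no_interior_max.

(** * The flatness estimate *)

Lemma cvg_test_expr (R : realType) (T : Type) (A : set_system T) (FA : Filter A)
    (z L d s : T -> R) (z0 L0 d0 s0 a b al M k h : R) :
  z t @[t --> A] --> z0 -> L t @[t --> A] --> L0 -> d t @[t --> A] --> d0 ->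
  s t @[t --> A] --> s0 ->
  z t ^+ 2 * (L t - a - d t) + al * s t ^+ 2 - M * expR (- (k * (L t - h))) @[t --> A] -->
  z0 ^+ 2 * (L0 - a - d0) + al * s0 ^+ 2 - M * expR (- (k * (L0 - h))).
Proof.
move=> hz hL hd hs.
have cE : expR (- (k * (L t - h))) @[t --> A] --> expR (- (k * (L0 - h))).
  apply: (continuous_cvg _ (@continuous_expR R _)).
  by apply: cvgN; apply: cvgM; [exact: cvg_cst|apply: cvgB => //; exact: cvg_cst].
apply: cvgB; last by apply: cvgM => //; exact: cvg_cst.
apply: cvgD; last by apply: cvgM; [exact: cvg_cst|rewrite expr2; apply: cvgM].
apply: cvgM; first by rewrite expr2; apply: cvgM.
by apply: cvgB => //; apply: cvgB => //; exact: cvg_cst.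
Qed.

Lemma cvg_subr (R : realType) (T : Type) (A : set_system T) (FA : Filter A)
    (f g : T -> R) (a b : R) :
  f t @[t --> A] --> a -> g t @[t --> A] --> b -> f t - g t @[t --> A] --> a - b.
Proof. by move=> fa gb; apply: cvgB. Qed.

Lemma test_fun_continuous (R : realType) (n : nat) (lo hi al M k h : R)
    (F v : 'rV[R]_n -> R) (e x : 'rV[R]_n) (U : set 'rV[R]_n) :
  0 <= lo -> lo <= hi -> quad_convex lo hi F -> open U -> Ck_on 1 U v -> U x ->
  {for x, continuous (test_fun F v e al M k h)}.
Proof.
move=> lo0 lohi hF oU hv Ux.
have idc i : (fun y : 'rV[R]_n => y 0 i) @ nbhs x --> x 0 i by exact: coord_continuous.
have gc i : (fun y : 'rV[R]_n => grad v y 0 i) @ nbhs x --> grad v x 0 i.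
  rewrite (_ : (fun y => _) = partial i v); last by apply/funext => y; rewrite mxE.
  by rewrite mxE; have [_ /(_ i)[_ [+ _]]] := hv; apply.
have Fc : (fun y => F (grad v y)) @ nbhs x --> F (grad v x).
  move=> B hB; have nB := @quad_convex_continuous R n lo hi F lo0 lohi hF (grad v x) B hB.
  have [r r0 hr] := nbhs_norm nB.
  have [r' r'0 hr'] := partials_near oU hv Ux r0.
  apply/nbhs_ballP; exists r' => // y; rewrite -ball_normE /= distrC => yr.
  apply: hr; apply: rV_norm_lt => // i; rewrite !mxE; exact: (hr' y yr).2.
have zc : cutoff y @[y --> nbhs x] --> cutoff x.
  apply: (@cvg_subr R _ (nbhs x) _ (fun=> 4) (fun y => dot y y)); first exact: cvg_cst.
  exact: (@cvg_dot R n 'rV[R]_n (nbhs x) _ id id).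
have dc : dot (grad F e) (grad v y - e) @[y --> nbhs x] --> dot (grad F e) (grad v x - e).
  apply: (@cvg_dot R n 'rV[R]_n (nbhs x) _ (fun=> grad F e) (fun y => grad v y - e)) => i.
    exact: cvg_cst.
  rewrite (_ : (fun y => _) = (fun y => grad v y 0 i - e 0 i)); last by apply/funext => y; rewrite !mxE.
  rewrite [X in _ --> X]mxE [X in _ --> _ + X]mxE.
  apply: (@cvg_subr R _ (nbhs x) _ (fun y => grad v y 0 i) (fun=> e 0 i)); first exact: gc.
  exact: cvg_cst.
have vc : v y - dot e y @[y --> nbhs x] --> v x - dot e x.
  apply: (@cvg_subr R _ (nbhs x) _ v (fun y => dot e y)); first by have [+ _] := hv; apply.
  by apply: (@cvg_dot R n 'rV[R]_n (nbhs x) _ (fun=> e) id) => // i; exact: cvg_cst.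
exact: (@cvg_test_expr R 'rV[R]_n (nbhs x) _ _ _ _ _ _ _ _ _ _ _ _ _ _ _ zc Fc dc vc).
Qed.

Lemma dot_continuous (R : realType) (n : nat) : continuous (fun x : 'rV[R]_n => dot x x).
Proof.
move=> x; apply: (@cvg_dot R n 'rV[R]_n (nbhs x) _ id id) => i; exact: coord_continuous.
Qed.

Lemma open_eball (R : realType) (n : nat) (r : R) : 0 <= r -> open (@eball R n r).
Proof.
move=> r0; rewrite (_ : @eball R n r = (fun x => dot x x) @^-1` `]-oo, r ^+ 2[%classic).
  by apply: open_comp => [x _|]; [exact: dot_continuous|exact: interval_open].
by apply/seteqP; split => x; rewrite /eball /= in_itv/= enorm_ltE.
Qed.

Lemma compact_dot_le (R : realType) (n : nat) (r : R) :
  compact [set x : 'rV[R]_n | dot x x <= r ^+ 2].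
Proof.
apply: bounded_closed_compact.
  exists `|r|; split=> [|M M1 x /= xr]; first exact: num_real.
  apply: rV_norm_le => [|i]; first by rewrite (le_trans _ (ltW M1)).
  apply: le_trans (ltW M1).
  have := le_trans (dot_entry_le x i) xr.
  rewrite -[x 0 i ^+ 2]real_normK ?num_real// -[r ^+ 2]real_normK ?num_real//.
  by rewrite ler_pXn2r// nnegrE.
rewrite (_ : [set x | _] = (fun x => dot x x) @^-1` [set s | s <= r ^+ 2])//.
by apply: closed_comp; [move=> x _; exact: dot_continuous|exact: closed_le].
Qed.

Lemma nbhs_mono (R : realType) (n : nat) (c : 'rV[R]_n) (P Q : set 'rV[R]_n) :
  nbhs c P -> (forall y, P y -> Q y) -> nbhs c Q.
Proof.
move=> /nbhs_norm[r r0 hr] PQ; apply/nbhs_ballP; exists r => // y.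
by rewrite -ball_normE /= distrC => /hr/PQ.
Qed.

Section scalar_facts.
Variable R : realFieldType.
Implicit Types a b d x y X : R.

Lemma cutoff_le16 d : 0 <= d -> d <= 2 ^+ 2 -> (4 - d) ^+ 2 <= 16.
Proof. rewrite !expr2; nra. Qed.

Lemma cutoff_ge9 d : 0 <= d -> d < 1 -> 9 <= (4 - d) ^+ 2.
Proof. rewrite expr2; nra. Qed.

Lemma barrier_wins a b x y : a <= b -> 0 <= x -> a + y - b <= x + y.
Proof. lra. Qed.

Lemma small_wins a b x y : a <= x -> 0 <= b -> a + y - b <= x + y.
Proof. lra. Qed.

Lemma slow_gradient (lo hi d X Fp Fe : R) :
  lo / 2 * X <= Fp -> Fe <= hi / 2 * 1 -> Fp < Fe - 2 * d -> 0 < d -> X * lo <= hi.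
Proof. lra. Qed.

Lemma final_constant (lo k a b s x X : R) :
  0 < lo -> 0 <= k -> 0 <= a -> 0 <= b -> 0 <= s -> 0 <= x ->
  9 * (lo / 2 * X) - b * x <= k * s + a * s ->
  X <= 2 / (9 * lo) * (k + a + b) * (s + x).
Proof.
move=> lo0 k0 a0 b0 s0 x0 h.
have h1 : 9 * (lo / 2 * X) <= (k + a + b) * (s + x).
  by have := mulr_ge0 k0 x0; have := mulr_ge0 a0 x0; have := mulr_ge0 b0 s0; lra.
have -> : X = 2 / (9 * lo) * (9 * (lo / 2 * X)) by field; rewrite gt_eqF.
by rewrite -[leRHS]mulrA; apply: ler_wpM2l => //; rewrite divr_ge0// mulr_ge0// ltW.
Qed.

End scalar_facts.

Section flatness.
Variables (R : realType) (n : nat) (lo hi : R).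
Hypotheses (n0 : (0 < n)%N) (lo0 : 0 < lo) (lohi : lo <= hi).

(** The factor is the reciprocal of [9 lo / 2]: the cutoff is at least [3] on the unit
    ball and the Bregman distance at least [lo/2] times the squared one. *)
Definition flatness_const : R :=
  2 / (9 * lo) * (hi / 2 * threshold_const lo hi n%:R + weight_const lo hi + barrier_const lo hi).

Let hi0 : 0 < hi. Proof. exact: lt_le_trans lohi. Qed.

(** Compare the test function at [x0], where the barrier term is at most a multiple of
    [exp (- mu delta / eps)], with its maximum over the ball of radius 2. The maximum
    is [O(sigma)]: on the sphere the cutoff vanishes; where [F (grad v)] is below the
    barrier level the gradient is bounded and the barrier outweighs the first term;
    elsewhere [no_interior_max] makes the first term [O(sigma)]. *)
Lemma flatness_estimate (F v : 'rV[R]_n -> R) (e x0 : 'rV[R]_n) (eps mu tau delta : R) :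
  quad_convex lo hi F -> F 0 = 0 -> (forall p, 0 <= F p) ->
  0 < eps -> eps <= 1 -> 0 <= mu -> mu * n%:R <= lo ->
  let U := @eball R n 3 in
  Ck_on 3 U v -> (forall x, U x -> aronsson_eps F eps v x = 0) ->
  dot e e = 1 -> 0 < tau -> tau <= 1 -> 0 < delta -> delta <= hi / 4 ->
  (forall y, U y -> `|v y - dot e y| <= tau) ->
  dot x0 x0 < 1 -> F e - delta <= F (grad v x0) ->
  dot (grad v x0 - e) (grad v x0 - e)
    <= flatness_const * (tau + delta + expR (- (mu * delta / eps))).
Proof.
move=> hF F0 Fge0 eps0 eps1 mu0 munlo U hv pde e1 tau0 tau1 delta0 deltahi flat x01 hx0.
have oU : open U by exact: open_eball.
have mulo : mu <= lo.
  by apply: le_trans munlo; rewrite ler_peMr// ler1n.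
pose A := weight_const lo hi; pose thr := threshold_const lo hi n%:R; pose M := barrier_const lo hi.
have A0 : 0 < A by exact: weight_const_gt0.
have thr0 : 0 < thr by exact: threshold_const_gt0.
have M0 : 0 < M by exact: barrier_const_gt0.
pose sigma := tau + delta.
have sigma0 : 0 < sigma by rewrite addr_gt0.
have sigmaS : sigma <= 1 + hi / 4 by rewrite lerD.
pose hs := F e - 2 * delta.
pose w := test_fun F v e (A / sigma) M (mu / eps) hs.
have four : 2 ^+ 2 = 4 :> R by ring.
pose K := [set x : 'rV[R]_n | dot x x <= 2 ^+ 2].
have KU x : K x -> U x.
  by rewrite /K /U /eball /= enorm_ltE// => h; apply: le_lt_trans h _; rewrite -subr_gt0; lra.
have x0K : K x0 by rewrite /K /=; apply: le_trans (ltW x01) _; rewrite expr2; lra.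
have [c cK cmax] : exists2 c, c \in K & forall t, t \in K -> w t <= w c.
  apply: EVT_max_rV; [by exists x0|exact: compact_dot_le|].
  apply: continuous_in_subspaceT => x; rewrite inE => /KU Ux.
  exact: (@test_fun_continuous R n lo hi _ _ _ _ F v e x U (ltW lo0) lohi hF oU (Ck_on_pred (Ck_on_pred hv)) Ux).
rewrite inE in cK; have Uc := KU _ cK.
have x0max : w x0 <= w c by apply: cmax; rewrite inE.
have breg p : lo / 2 * dot (p - e) (p - e) <= bregman F e p <= hi / 2 * dot (p - e) (p - e).
  exact: (quad_convex_expansion (ltW lo0) lohi hF e p).
have s2 y : U y -> A / sigma * (v y - dot e y) ^+ 2 <= A * sigma.
  move=> Uy; rewrite (_ : A * sigma = A / sigma * sigma ^+ 2); last by field; rewrite gt_eqF.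
  rewrite ler_pM2l ?divr_gt0// -[leLHS]real_normK ?num_real// ler_pXn2r ?nnegrE ?(ltW sigma0)//.
  by apply: le_trans (flat y Uy) _; rewrite lerDl ltW.
have c0 := dot_ge0 c; have z2 : 0 <= cutoff c ^+ 2 := sqr_ge0 _.
have z16 : cutoff c ^+ 2 <= 16 by exact: cutoff_le16.
pose E := expR (- (mu / eps * (F (grad v c) - hs))).
have /andP[gl gu] := breg (grad v c).
have wE : w c <= cutoff c ^+ 2 * bregman F e (grad v c) + A * sigma - M * E.
  by rewrite lerD2r lerD2l; exact: s2.
have ME0 : 0 <= M * E by rewrite mulr_ge0 ?expR_ge0// ltW.
have As0 : 0 <= A * sigma by rewrite mulr_ge0// ltW.
have ts0 : 0 <= hi / 2 * thr * sigma by rewrite mulr_ge0 ?(ltW sigma0)// mulr_ge0 ?divr_ge0// ltW.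
have wc : w c <= hi / 2 * thr * sigma + A * sigma.
  apply: le_trans wE _.
  have [c4|c4] := leP 4 (dot c c).
    have -> : cutoff c = 0.
      by apply/eqP; rewrite subr_eq0 eq_le c4 -four.
    by rewrite expr0n mul0r; apply: small_wins.
  have [good|bad] := leP hs (F (grad v c)); last first.
    apply: barrier_wins => //.
    have E1 : 1 <= E.
      rewrite -expR0 ler_expR -mulrN mulr_ge0 ?divr_ge0// ?(ltW eps0)//.
      by rewrite oppr_ge0 subr_le0 ltW.
    have pb : dot (grad v c) (grad v c) <= hi / lo.
      rewrite ler_pdivlMr//.
      have h1 := min_lower_bound lo0 lohi hF F0 Fge0 (grad v c).
      have h2 := min_upper_bound lo0 lohi hF F0 Fge0 e.
      rewrite e1 in h2; exact: (slow_gradient h1 h2 bad delta0).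
    apply: (@le_trans _ _ M); last by rewrite ler_peMr// ltW.
    apply: (@le_trans _ _ (16 * bregman F e (grad v c))).
      by rewrite ler_wpM2r//; apply: le_trans gl; rewrite mulr_ge0 ?dot_ge0// divr_ge0// ltW.
    have hb : bregman F e (grad v c) <= hi * (hi / lo + 1).
      apply: le_trans gu _.
      have -> : hi * (hi / lo + 1) = hi / 2 * (2 * (hi / lo) + 2 * 1) by field; rewrite gt_eqF.
      rewrite ler_pM2l ?divr_gt0//; apply: le_trans (dot_subD_le _ _) _.
      by rewrite e1 lerD2r ler_pM2l.
    by rewrite /M /barrier_const -mulrA ler_pM2l.
  have [big|small] := leP (thr * sigma) (cutoff c ^+ 2 * dot (grad v c - e) (grad v c - e)).
    exfalso.
    apply: (@no_interior_max R n lo hi eps mu F v U lo0 lohi hF F0 Fge0 oU hv eps0 eps1 pde mu0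
      mulo munlo e sigma tau delta M e1 (ltW M0) sigma0 sigmaS _ _ flat c Uc c4) => //.
    - by rewrite lerDl ltW.
    - by rewrite lerDr ltW.
    - have c2 : eball 2 c by rewrite /eball /= enorm_ltE// -natrX.
      apply: (nbhs_mono (@open_nbhs_nbhs _ c _ (conj (@open_eball R n 2 (ler0n _ _)) c2))) => y y2.
      by apply: cmax; rewrite inE /K /=; apply: ltW; rewrite -enorm_ltE.
  apply: small_wins => //.
  apply: le_trans (ler_wpM2l z2 gu) _; rewrite mulrCA -mulrA ler_pM2l ?divr_gt0//.
  exact: ltW.
have /andP[bl _] := breg (grad v x0).
set X := dot (grad v x0 - e) _ in bl *; set ex := expR (- (mu * delta / eps)).
have X0 : 0 <= X by exact: dot_ge0.
have lower : 9 * (lo / 2 * X) - M * ex <= w x0.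
  apply: lerB.
    rewrite -[leLHS]addr0; apply: lerD; last by rewrite mulr_ge0 ?sqr_ge0// divr_ge0// ltW.
    have lX : 0 <= lo / 2 * X by rewrite mulr_ge0// divr_ge0// ltW.
    apply: ler_pM => //.
    exact: cutoff_ge9 (dot_ge0 x0) x01.
  rewrite ler_pM2l// ler_expR lerN2 mulrAC; apply: ler_wpM2l; first by rewrite divr_ge0// ltW.
  by rewrite lerBrDr /hs addrC; apply: le_trans hx0; rewrite mulr_natl mulr2n opprD addrA subrK.
have ex0 : 0 <= ex by exact: expR_ge0.
have t1 : 0 <= hi / 2 * thr by rewrite mulr_ge0 ?divr_ge0// ltW.
exact: (final_constant lo0 t1 (ltW A0) (ltW M0) (ltW sigma0) ex0
  (le_trans lower (le_trans x0max wc))).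
Qed.

End flatness.

Lemma half_le_quarter (F : realFieldType) (L h d : F) :
  d < h / 2 -> h <= L / 2 * 1 -> d <= L / 4.
Proof. by move=> *; lra. Qed.

Lemma regularization_rate_le (F : realFieldType) (n : nat) (l : F) : (0 < n)%N -> 0 < l ->
  0 <= l / (16 * n%:R) /\ l / (16 * n%:R) * n%:R <= l.
Proof.
move=> n0 l0; have nn : 0 < n%:R :> F by rewrite ltr0n.
split; first by rewrite divr_ge0 ?mulr_ge0// ltW.
rewrite (_ : _ * _ = l / 16); last by field; rewrite gt_eqF.
by rewrite ler_pdivrMr// ler_peMr ?(ltW l0)// ler1n.
Qed.

Lemma e_last_unit (R : realType) (n : nat) : (0 < n)%N -> dot (e_last R n) (e_last R n) = 1.
Proof.
case: n => // n _; rewrite /dot (bigD1 ord_max)//= big1 ?addr0.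
  by rewrite mxE /= eqxx mulr1.
move=> i ni; rewrite mxE; case: eqP => [|_]; last by rewrite mul0r.
by move=> [] ie; case/negP: ni; apply/eqP/val_inj.
Qed.

Unset Implicit Arguments.

Theorem theorem2p4 (R : realType) (n : nat) (hn : (3 <= n)%N)
    (lambda Lambda : R) (hlambda : 0 < lambda) (hLambda : lambda <= Lambda) :
  exists C1 : R,
    forall (H : 'rV[R]_n -> R) (Omega : set 'rV[R]_n) (u : 'rV[R]_n -> R)
      (gamma eps : R) (pgamma : 'rV[R]_n) (ugamma ugammaeps : 'rV[R]_n -> R)
      (tau delta : R) (x0 : 'rV[R]_n),
    let U := @eball R n 3 in
    let Hgamma := regularized gamma H pgamma in
    let mu := lambda / (16 * n%:R) in
    admissible lambda Lambda H ->
    domain Omega ->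
    absolute_minimizer H Omega u ->
    compactly_contained U Omega ->
    0 < gamma <= 1 ->
    unique_min_point (mollify gamma H) pgamma ->
    absolute_minimizer Hgamma U ugamma ->
    {within closure U, continuous ugamma} ->
    (forall x, frontier U x -> ugamma x = u x) ->
    0 < eps <= 1 ->
    is_solution_eps Hgamma eps U ugamma ugammaeps ->
    0 < tau < 1 ->
    (forall x, U x -> `|ugammaeps x - dot x (e_last R n)| <= tau) ->
    0 < delta < H (e_last R n) / 2 ->
    eball 1 x0 ->
    Hgamma (e_last R n) - delta <= Hgamma (grad ugammaeps x0) ->
    enorm (grad ugammaeps x0 - e_last R n) ^+ 2
      <= C1 * (tau + delta + eps^-1 * expR (- (mu * delta / eps))).
Proof.
have n0 : (0 < n)%N by exact: leq_trans hn.
have Lambda0 : 0 < Lambda by exact: lt_le_trans hLambda.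
have C0 : 0 <= flatness_const n lambda Lambda.
  have t0 := threshold_const_gt0 hlambda Lambda0 (ler0n R n).
  have w0 := weight_const_gt0 hlambda Lambda0.
  have b0 := barrier_const_gt0 hlambda Lambda0.
  rewrite /flatness_const; apply: mulr_ge0; first by rewrite divr_ge0// mulr_ge0// ltW.
  by rewrite !addr_ge0 ?(ltW w0) ?(ltW b0)// mulr_ge0 ?(ltW t0)// divr_ge0// ltW.
exists (flatness_const n lambda Lambda).
move=> H Omega u gamma eps pgamma ugamma v tau delta x0 U Hg mu.
move=> aH _ _ _ hgamma pmin _ _ _ /andP[eps0 eps1] [sv _ pde _] /andP[tau0 tau1] flat
  /andP[delta0 deltaH] x01 hx0.
have [cH _ _ H0 Hge0] := aH.
have qH := admissible_quad_convex aH.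
have qHg : quad_convex lambda Lambda Hg := regularized_quad_convex pgamma hgamma aH.
have Hg0 : Hg 0 = 0 by rewrite /Hg /regularized add0r subrr.
have Hgge0 p : 0 <= Hg p.
  rewrite /Hg /regularized subr_ge0; have [->|/pmin/ltW//] := eqVneq (p + pgamma) pgamma.
  exact: lexx.
have e1 := e_last_unit R n0.
(* This is what bounds sigma in terms of Lambda. *)
have deltaL : delta <= Lambda / 4.
  have := min_upper_bound hlambda hLambda qH H0 Hge0 (e_last R n).
  by rewrite e1; exact: half_le_quarter deltaH.
have [mu0 mun] := regularization_rate_le n0 hlambda.
have x0' : dot x0 x0 < 1 by move: x01; rewrite /eball /= enorm_ltE// expr1n.
have flat' y : U y -> `|v y - dot (e_last R n) y| <= tau by move=> Uy; rewrite dotC; exact: flat.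
rewrite enorm_sq.
apply: le_trans (flatness_estimate n0 hlambda hLambda qHg Hg0 Hgge0 eps0 eps1 mu0 mun (sv 3%N) pde
  e1 tau0 (ltW tau1) delta0 deltaL flat' x0' hx0) _.
rewrite ler_wpM2l// lerD2l ler_peMl ?expR_ge0// invf_ge1//.
Qed.
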